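(* Let $N=32\cdot2^t$ with $t\ge0$ an integer, and let $X$ be the maximal regular design of resolution IV with $N$ runs and $5N/16$ factors (constructed by doubling as in the context). Let $D$ and $\overline{D}$ be a pair of complementary projection designs of $X$, with $n$ and $u=5N/16-n$ columns respectively, where $17N/64\le n\le5N/16$. Then $D$ has minimum aberration among all regular designs with $N$ runs and $n$ factors if $\overline{D}$ satisfies the following two conditions: (i) $A_4(\overline{D}),-A_5(\overline{D}),A_6(\overline{D}),-A_7(\overline{D}),\ldots$ are sequentially minimized among all $u$-factor projection designs of $X$; (ii) $|f_i-f_j|\le1$ for all $1\le i<j\le5$, where $f_i$ is the number of columns of $\overline{D}$ generated from the $i$th column of $X_0$.
   Context: Two-level regular design: a matrix with entries $0,1$ having $N=2^k$ rows (runs) and $n$ columns (factors) whose rows, up to order, are $(\langle a_1,x\rangle,\dots,\langle a_n,x\rangle)$, $x\in\mathbb{F}_2^k$, for some $a_1,\dots,a_n\in\mathbb{F}_2^k$. All regular designs here are two-level. A defining word of length $i\ge1$ is a set of $i$ columns whose sum is the zero vector mod 2. $A_i(D)$ is the number of defining words of length $i$ of $D$ ($A_i(D)=0$ if $i$ exceeds the number of columns). A design has minimum aberration within a class of designs with the same numbers of runs and factors if it sequentially minimizes $A_1,A_2,\dots,A_n$ over the class, i.e. its vector $(A_1,\dots,A_n)$ is lexicographically smallest. In general, ''sequentially minimized'' means that the vector is lexicographically smallest. Doubling: the double of a $0/1$ matrix $Y$ is $\begin{pmatrix} Y & Y \\ Y & Y+1 \end{pmatrix}$ (mod 2). Each doubling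 replaces a column $c$ by the two columns $\binom{c}{c}$ and $\binom{c}{c+1}$, which are said to be generated from $c$ (and so on for repeated doubling). $X_0$ is the $16\times5$ regular design defined by $I=ABCDE$: its rows are the 16 vectors of $\mathbb{F}_2^5$ of even weight. $X$ is obtained by doubling $X_0$ $t+1$ times; it has $N=32\cdot 2^t$ rows and $5\cdot2^{t+1}=5N/16$ columns, and each column of $X_0$ generates $2^{t+1}$ columns of $X$. A $u$-factor projection design of $X$ is the submatrix of $X$ formed by $u$ of its columns (all rows retained). Complementary projection designs $D,\overline{D}$ of $X$ are formed by a subset of the columns and by the complementary subset. *)

(* Defs.v *)
(* Designs are matrices over 'F_2: rows are runs, columns are factors. *)
From HB Require Import structures.
From mathcomp Require Import all_boot all_order all_algebra.

Set Implicit Arguments.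
Unset Strict Implicit.
Unset Printing Implicit Defensive.

Import Order.TTheory GRing.Theory Num.Theory.
Local Open Scope ring_scope.

Definition regular_design (N n : nat) (Y : 'M['F_2]_(N, n)) : Prop :=
  exists (k : nat) (a : 'I_n -> 'rV['F_2]_k) (x : 'I_N -> 'rV['F_2]_k),
    [/\ N = (2 ^ k)%N, bijective x
      & forall i j, Y i j = \sum_(l < k) a j 0 l * x i 0 l].

(* Meaningful for i >= 1 only: for i = 0 it counts the empty set. *)
Definition A (N n : nat) (i : nat) (Y : 'M['F_2]_(N, n)) : nat :=
  #|[set S : {set 'I_n} | (#|S| == i) && (\sum_(j in S) col j Y == 0)]|.

(* Lexicographic order; only used on sequences of equal length. *)
Definition lex_le (s1 s2 : seq int) : bool :=
  ((s1 : seqlexi int) <= (s2 : seqlexi int))%O.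

(* (A_1, ..., A_n) *)
Definition wordlength_pattern (N n : nat) (Y : 'M['F_2]_(N, n)) : seq int :=
  [seq (A i Y)%:Z | i <- iota 1 n].

(* (A_4, - A_5, A_6, - A_7, ..., (-1)^n A_n); all later terms vanish. *)
Definition signed_pattern (N n : nat) (Y : 'M['F_2]_(N, n)) : seq int :=
  [seq (-1) ^+ i * (A i Y)%:Z | i <- iota 4 (n - 3)].

Definition seq_minimized (T : Type) (pat : T -> seq int) (P : T -> Prop)
    (D : T) : Prop :=
  P D /\ forall D' : T, P D' -> lex_le (pat D) (pat D').

Definition minimum_aberration (N n : nat) (P : 'M['F_2]_(N, n) -> Prop)
    (D : 'M['F_2]_(N, n)) : Prop :=
  seq_minimized (@wordlength_pattern N n) P D.

Definition double (N n : nat) (Y : 'M['F_2]_(N, n)) : 'M['F_2]_(N + N, n + n) :=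
  block_mx Y Y Y (Y + const_mx 1).

Definition dsize (s m : nat) : nat := iter s (fun p => p + p)%N m.

Fixpoint doubles (N n : nat) (Y : 'M['F_2]_(N, n)) (s : nat) :
    'M['F_2]_(dsize s N, dsize s n) :=
  if s is s'.+1 then double (doubles Y s') else Y.

(* Column j of [doubles Y s] is generated from column [source s j] of Y:
   in [double Y], columns [lshift n c] and [rshift n c] come from column c. *)
Fixpoint source (n s : nat) : 'I_(dsize s n) -> 'I_n :=
  match s return 'I_(dsize s n) -> 'I_n with
  | 0 => id
  | s'.+1 => fun j => match split j with inl c | inr c => source c end
  end.

Lemma dsizeE (s m : nat) : dsize s m = (m * 2 ^ s)%N.
Proof.
elim: s => [|s IHs]; first by rewrite muln1.
by rewrite /dsize iterS -/(dsize s m) IHs addnn -mul2n mulnCA expnS.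
Qed.

Definition num_runs (t : nat) : nat := (32 * 2 ^ t)%N.
Definition num_factors (t : nat) : nat := (5 * 2 ^ t.+1)%N.

Lemma num_runsE (t : nat) : dsize t.+1 16 = num_runs t.
Proof. by rewrite dsizeE expnS mulnA. Qed.

Lemma num_factorsE (t : nat) : dsize t.+1 5 = num_factors t.
Proof. exact: dsizeE. Qed.

(* The defining relation I = ABCDE fixes X0 only up to the order of its runs. *)
Definition is_X0 (X0 : 'M['F_2]_(16, 5)) : Prop :=
  injective (fun i => row i X0) /\
  forall v : 'rV['F_2]_5,
    ~~ odd #|[set j | v 0 j != 0]| <-> exists i, row i X0 = v.

Definition designX (X0 : 'M['F_2]_(16, 5)) (t : nat) :
    'M['F_2]_(num_runs t, num_factors t) :=
  castmx (num_runsE t, num_factorsE t) (doubles X0 t.+1).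

Definition designX_source (t : nat) (j : 'I_(num_factors t)) : 'I_5 :=
  source (cast_ord (esym (num_factorsE t)) j).

Definition projection_design (N m u : nat) (X : 'M['F_2]_(N, m))
    (E : 'M['F_2]_(N, u)) : Prop :=
  exists2 g : 'I_u -> 'I_m, injective g & E = colsub g X.

(* Main.v *)
(* If some A_i with i <= 3 of a competitor is nonzero, it loses at once.  Otherwise
   its columns form a sum-free set S in F_2^k, and factoring out vectors that are
   not in S + S + S preserves sum-freeness and density, until S' + S' + S' covers
   every nonzero vector of F_2^k'.  Either |S'| <= 1, the even-word case k' = 1, or
   S' contains a pentagon x1 + ... + x5 = 0.  Every translate of the 4-dimensional
   span of a pentagon meets S' in an independent set of the Clebsch graph: at most
   5 points, and 5 only for a neighbourhood, that is for a translated pentagon.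
   Two parallel pentagons would force density at most 33/128 < 17/64, so
   |S'| <= |F_2^k'| / 4 + 1, and the density 17/64 leaves k' = 4, 5, 6.

   A_4 is an increasing function of the fourth moment of the character sums.  For
   k' = 1, 5, 6 convexity of x^4 bounds this moment below by values that exceed
   the moment of D.  For k' = 4 the competitor D' is a projection of X.  There
   A_4(D) - A_4(D-bar) is an increasing function of the power sums of order 2 and
   3 of the f_i, minimal exactly when the f_i are balanced; and when the f_i agree
   up to order, the word length enumerators satisfy
     (1 - z^2)^u (W_D(z) - W_D'(z))
       = (1 - z^2)^(5N/32) (W_D-bar(-z) - W_D'-bar(-z)),
   so the first differing coefficients are equal up to the sign (-1)^i, which is
   what condition (i) controls. *)
Require Import Defs.
From Stdlib Require Import NArith.
From HB Require Import structures.
From mathcomp Require Import all_boot all_order all_fingroup all_algebra.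
From mathcomp Require Import zify ring lra.

Set Implicit Arguments.
Unset Strict Implicit.
Unset Printing Implicit Defensive.

Import Order.TTheory GRing.Theory Num.Theory.

(** * Finite checks in the Clebsch graph *)

(** Distinct columns fix the second moment, so among competitors with A_1 = A_2 = A_3 = 0 comparing
    A_4 means comparing fourth moments. These behave well under quotients: the characters of a
    quotient are some of the characters of the whole space, and fourth powers are nonnegative. In
    the quotient a competitor becomes a weight on S' with values at most 2^(k-k'), and the obstacle
    is to bound its moment without classifying S'. A pentagon in S' supplies coordinates in which
    every other translate of its span carries one of finitely many 4-point sets, so dimensions 5 and
    6 are settled by enumeration. Against k' = 1, 5, 6 a crude estimate for D is enough: D-bar has u
    <= 3N/64 columns, its moment is at most N u^3, and otherwise only the power sums of the balanced
    f_i enter. The enumerator identity is proved one character at a time: a character that is not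
    constant on the classes of X (the columns generated from one column of X0) takes both signs
    equally often in each class, while one that is constant on the classes sees only the f_i. *)

(* Vectors of F_2^k are encoded as binary numbers, with [N.lxor] as addition. *)
Definition below (n : nat) : seq N := [seq N.of_nat i | i <- iota 0 n].

(* Locked: otherwise simplification unfolds the sixteen vertices everywhere. *)
HB.lock Definition vertices : seq N := below 16.

(** Independent sets of the Cayley graph with connection set [g], listed as sublists of [vs] in
    their order, so that a filtered list is literally a member. With [g = [::]] all sublists are
    obtained. *)
Definition independent_sets (g vs : seq N) : seq (seq N) :=
  foldr (fun v L =>
           L ++ [seq v :: s | s <- L & all (fun a => N.lxor v a \notin g) s])
        [:: [::]] vs.

Lemma independent_setsP (g vs : seq N) (J : pred N) :
  {in vs &, forall a b, J a -> J b -> N.lxor a b \notin g} ->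
  [seq v <- vs | J v] \in independent_sets g vs.
Proof.
elim: vs => [//|v vs IH] Hg /=.
have IH' : [seq v <- vs | J v] \in independent_sets g vs.
  by apply: IH => a b Ha Hb; apply: Hg; rewrite inE ?Ha ?Hb orbT.
rewrite mem_cat; case: ifP => Jv; last by rewrite IH'.
apply/orP; right; apply/mapP; exists [seq v <- vs | J v] => //.
rewrite mem_filter IH' andbT; apply/allP => a; rewrite mem_filter => /andP[Ja Ha].
by apply: Hg; rewrite // inE ?eqxx ?Ha ?orbT.
Qed.

(* Connection set of the Clebsch graph: four basis vectors and their sum. *)
Definition pentad : seq N := [:: 1; 2; 4; 8; 15]%num.

Definition clebsch : seq (seq N) := independent_sets pentad (below 16).

Lemma clebschE : clebsch = independent_sets pentad vertices.
Proof. by rewrite vertices.unlock. Qed.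

(** The non-neighbours of a vertex form a Petersen graph, whose independence number is 4; hence the
    5. The enumeration also yields the common neighbour [v] of five independent points. *)
Lemma clebschP (s : seq N) : s \in clebsch ->
  size s <= 5 /\ (size s = 5 ->
    exists2 v, v \in vertices & forall g, g \in pentad -> N.lxor v g \in s).
Proof.
have/allP H : all (fun s : seq N => (size s <= 5) && ((size s == 5) ==>
    has (fun v => all (fun g => N.lxor v g \in s) pentad) (below 16))) clebsch.
  by vm_compute.
rewrite vertices.unlock => /H/andP[-> /implyP H5]; split=> // /eqP/H5/hasP[v Hv /allP Hg].
by exists v.
Qed.

Lemma clebsch_pentad (s : seq N) : s \in clebsch ->
  {subset pentad <= s} -> s = pentad.
Proof.
have/allP H : all (fun s : seq N => all (mem s) pentad ==> (s == pentad)) clebsch.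
  by vm_compute.
by move=> /H/implyP Hs /allP/Hs/eqP.
Qed.

Definition disj (s1 s2 : seq N) := all (fun v => v \notin s2) s1.
(** A pair stands for the traces of S | (S + g) and S & (S + g) on a translate of the span of a
    pentagon; its score counts the points of S and of S + g there. *)
Definition compatible (p q : seq N * seq N) := disj p.1 q.2 && disj q.1 p.2.
Definition score (p : seq N * seq N) := size p.1 + size p.2.
Definition subsets (s : seq N) := independent_sets [::] s.
Definition clebsch_pairs : seq (seq N * seq N) :=
  flatten [seq [seq (s, d) | d <- subsets s] | s <- clebsch].

(* The kernel computation below replaces disjointness of lists by a bitwise [and]
   of their characteristic masks. *)
Definition mask (s : seq N) : N := foldr (fun v m => N.setbit m v) 0%num s.

Lemma testbit_mask s v : N.testbit (mask s) v = (v \in s).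
Proof.
elim: s => [|a s IH] /=; first by case: v.
by rewrite N.setbit_eqb IH inE eq_sym.
Qed.

Lemma land_mask s1 s2 : disj s1 s2 -> N.land (mask s1) (mask s2) = 0%num.
Proof.
move=> /allP H; apply: N.bits_inj_0 => v; rewrite N.land_spec !testbit_mask.
by case: (boolP (v \in s1)) => // /H /negbTE ->.
Qed.

(* Written with [match] because [vm_compute] evaluates both arguments of [&&]. *)
Definition mask_compatible (p q : (N * N) * nat) : bool :=
  if N.land p.1.1 q.1.2 is N0 then
    if N.land q.1.1 p.1.2 is N0 then true else false
  else false.
Definition encode (p : seq N * seq N) := (mask p.1, mask p.2, score p).

Lemma mask_compatibleP p q : compatible p q -> mask_compatible (encode p) (encode q).
Proof. by case/andP=> H1 H2; rewrite /mask_compatible /= !land_mask. Qed.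

(** Excludes compatible pairs of total score at least [t]. One of the two scores is at least half
    the total, and the outer filter lets only such pairs start a search. *)
Definition tail_ok (P : seq ((N * N) * nat)) (t : nat) :=
  all (fun p => all (fun q => ~~ mask_compatible p q) [seq q <- P | t <= p.2 + q.2])
      [seq p <- P | t <= p.2 + p.2].

(* Once the first pair is [(pentad, d)], a total above 33 needs a pair of score at
   least 8 among the other three, so it suffices to start from such a pair [p]. *)
Definition score_ok (Q : seq (seq N * seq N)) (d : seq N) :=
  let P := [seq p <- [seq encode p | p <- Q] |
              mask_compatible (encode (pentad, d)) p] in
  all (fun p => tail_ok [seq q <- P | mask_compatible p q] (29 - size d - p.2))
      [seq p <- P | 8 <= p.2].

Lemma scores_ok : all (score_ok clebsch_pairs) [seq d <- subsets pentad | 4 <= size d].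
Proof. by vm_compute. Qed.

Lemma tail_okP P t p q : tail_ok P t -> p \in P -> q \in P ->
  mask_compatible p q -> p.2 + q.2 < t.
Proof.
move=> /allP H Hp Hq Hc; rewrite ltnNge; apply/negP => Ht.
have {}H a b : a \in P -> b \in P -> b.2 <= a.2 ->
    t <= a.2 + b.2 -> ~~ mask_compatible a b.
  move=> Ha Hb ab tab; have := H a; rewrite mem_filter Ha andbT.
  case: leqP => [_|ta _]; last first.
    by exfalso; move: ab tab ta; clear; move: (a.2) (b.2) => x y; lia.
  by move=> /(_ isT)/allP/(_ b); rewrite mem_filter Hb tab => /(_ isT).
have [Hpq|Hqp] := leqP q.2 p.2.
  by have := H p q Hp Hq Hpq Ht; rewrite Hc.
have := H q p Hq Hp (ltnW Hqp); rewrite addnC => /(_ Ht).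
by move: Hc; rewrite /mask_compatible; do 2![case: (N.land _ _) => //].
Qed.

Lemma score_okP Q d a b c : score_ok Q d -> a \in Q -> b \in Q -> c \in Q ->
  compatible (pentad, d) a -> compatible (pentad, d) b -> compatible (pentad, d) c ->
  compatible a b -> compatible a c -> compatible b c -> 8 <= score a ->
  score b + score c < 29 - size d - score a.
Proof.
move=> /allP H Ha Hb Hc ca cb cc ab ac bc sa.
have := H (encode a); rewrite !mem_filter map_f // mask_compatibleP // sa.
move=> /(_ isT)/tail_okP/(_ _ _ (mask_compatibleP bc)); apply.
  by rewrite !mem_filter map_f // !mask_compatibleP.
by rewrite !mem_filter map_f // !mask_compatibleP.
Qed.

Lemma compatibleC p q : compatible p q = compatible q p.
Proof. by rewrite /compatible andbC. Qed.

Lemma score_pairs p : p \in clebsch_pairs -> score p <= 10.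
Proof.
move=> /flattenP[l /mapP[s Hs ->] /mapP[e He ->]].
have /allP/(_ _ Hs)/allP/(_ _ He)// : all (fun s : seq N =>
  all (fun e : seq N => score (s, e) <= 10) (subsets s)) clebsch.
by vm_compute.
Qed.

Lemma size_subset_pentad d : d \in subsets pentad -> size d <= 5.
Proof.
have /allP H : all (fun e : seq N => size e <= 5) (subsets pentad) by vm_compute.
exact: H.
Qed.

Lemma score_bound d p q r :
  d \in subsets pentad -> 4 <= size d ->
  p \in clebsch_pairs -> q \in clebsch_pairs -> r \in clebsch_pairs ->
  compatible (pentad, d) p -> compatible (pentad, d) q -> compatible (pentad, d) r ->
  compatible p q -> compatible p r -> compatible q r ->
  5 + size d + score p + score q + score r <= 33.
Proof.
move=> Hd sd Hp Hq Hr cp cq cr pq pr qr.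
have Hall a b c : a \in clebsch_pairs -> b \in clebsch_pairs -> c \in clebsch_pairs ->
  compatible (pentad, d) a -> compatible (pentad, d) b -> compatible (pentad, d) c ->
  compatible a b -> compatible a c -> compatible b c -> 8 <= score a ->
  score a + score b + score c < 29 - size d \/ 29 - size d <= score a.
  move=> Ha Hb Hc ca cb cc ab ac bc sa.
  (* The subtraction in [score_ok] truncates, so this case is kept apart; the bounds 10 on scores
     and 5 on [size d] exclude it below. *)
  have [|sa'] := leqP (29 - size d) (score a); first by right.
  left; have /allP/(_ d) := scores_ok; rewrite mem_filter sd Hd => /(_ isT) H.
  have Hbc := score_okP H Ha Hb Hc ca cb cc ab ac bc sa.
  move: Hbc sa'; clear.
  by move: (score a) (score b) (score c) (size d) => x y z k; lia.
have sp := score_pairs Hp; have sq := score_pairs Hq; have sr := score_pairs Hr.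
have sd5 := size_subset_pentad Hd.
have [p8|p8] := leqP 8 (score p).
  have := Hall p q r Hp Hq Hr cp cq cr pq pr qr p8.
  move: sp sq sr sd5; clear.
  by move: (score p) (score q) (score r) (size d) => x y z k ? ? ? ? []; lia.
have [q8|q8] := leqP 8 (score q).
  have := Hall q p r Hq Hp Hr cq cp cr _ qr pr q8; rewrite 1?compatibleC // => /(_ pq).
  move: sp sq sr sd5; clear.
  by move: (score p) (score q) (score r) (size d) => x y z k ? ? ? ? []; lia.
have [r8|r8] := leqP 8 (score r).
  have := Hall r p q Hr Hp Hq cr cp cq _ _ pq r8; rewrite ![compatible r _]compatibleC.
  move=> /(_ pr qr); move: sp sq sr sd5; clear.
  by move: (score p) (score q) (score r) (size d) => x y z k ? ? ? ? []; lia.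
move: p8 q8 r8 sd5; clear.
by move: (score p) (score q) (score r) (size d) => x y z k; lia.
Qed.

(* [has] would evaluate both sides of its [||] under [vm_compute]. *)
Fixpoint lazy_has (a : pred N) (s : seq N) : bool :=
  if s is v :: s' then if a v then true else lazy_has a s' else false.

Lemma lazy_hasE a s : lazy_has a s = has a s.
Proof. by elim: s => //= v s ->; case: (a v). Qed.

Definition rep_count (s : seq N) (M : N) (y : N) : nat :=
  count (fun a => N.testbit M (N.lxor a y)) s.

(** Additive energy when [vs] lists the whole space: ordered quadruples from [s] with zero sum. *)
Definition energy (s vs : seq N) : nat :=
  let M := mask s in sumn [seq rep_count s M y ^ 2 | y <- vs].

(** Ordered triples from [s] with sum [i]. *)
Definition triples (s : seq N) (i : N) : nat :=
  let M := mask s in sumn [seq rep_count s M (N.lxor a i) | a <- s].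

Definition covered (s vs : seq N) : bool :=
  let M := mask s in
  all (fun y => if y is N0 then true else
    lazy_has (fun a => lazy_has (fun b =>
      N.testbit M (N.lxor (N.lxor a b) y)) s) s) vs.

Definition clebsch4 : seq (seq N) := [seq s <- clebsch | size s == 4].

(* The reduced sets of dimensions 5 and 6: bits 4 and 5 select the translate of the
   span of the pentagon. *)
Definition cap9 (s : seq N) : seq N := pentad ++ [seq N.lxor 16 m | m <- s].

Definition cap17 (s1 s2 s3 : seq N) : seq N :=
  pentad ++ [seq N.lxor 16 m | m <- s1] ++ [seq N.lxor 32 m | m <- s2]
         ++ [seq N.lxor 48 m | m <- s3].

(** In dimension 5 the density allows fibres over S' that are not completely filled; the bound on
    triples pays for these gaps. In dimension 6 all fibres turn out to be full, and the energy alone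
    suffices. *)
Lemma cap9_ok (s : seq N) : s \in clebsch4 -> covered (cap9 s) (below 32) ->
  393 <= energy (cap9 s) (below 32) /\
  {in cap9 s, forall i, triples (cap9 s) i <= 49}.
Proof.
have /allP H : all (fun s => covered (cap9 s) (below 32) ==>
    (393 <= energy (cap9 s) (below 32)) &&
    all (fun i => triples (cap9 s) i <= 49) (cap9 s)) clebsch4 by vm_compute.
by move=> Hs Hc; have := H s Hs; rewrite Hc => /andP[-> /allP].
Qed.

(* The two shapes, up to translation, of a 4-element independent set. *)
Definition normal (s : seq N) : bool :=
  all (mem pentad) s ||
  (0%num \in s) && all (fun a => all (fun b => N.lxor a b \in s) s) s.

(** The representatives of two translates of the span can be moved freely inside them, so two of the
    three slices in dimension 6 may be taken in normal form; this fixes the representative of the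
    third, which therefore stays arbitrary. *)
Lemma normalize (s : seq N) : s \in clebsch4 ->
  exists2 v, v \in vertices & normal [seq m <- vertices | N.lxor v m \in s].
Proof.
have /allP H : all (fun s : seq N => has (fun v =>
    normal [seq m <- below 16 | N.lxor v m \in s]) (below 16)) clebsch4.
  by vm_compute.
by rewrite vertices.unlock => /H/hasP.
Qed.

Definition cap17_good (s1 s2 s3 vs : seq N) : bool :=
  let s := cap17 s1 s2 s3 in
  if 2273 <= energy s vs then true else ~~ covered s vs.

Definition cap17_check : bool :=
  let vs := below 64 in
  let normals := [seq s <- clebsch4 | normal s] in
  let codes := [seq (mask s, s) | s <- clebsch4] in
  all (fun s1 => all (fun s2 =>
    (* Sum-freeness keeps the third slice disjoint from [s1 + s2]. *)
    let f := mask [seq N.lxor a b | a <- s1, b <- s2] in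
    all (fun c => cap17_good s1 s2 c.2 vs)
        [seq c <- codes | N.land c.1 f == 0%num]) normals) normals.

Lemma cap17_checked : cap17_check.
Proof. by vm_compute. Qed.

Lemma cap17_ok (s1 s2 s3 : seq N) :
  s1 \in clebsch4 -> normal s1 -> s2 \in clebsch4 -> normal s2 -> s3 \in clebsch4 ->
  (forall a b, a \in s1 -> b \in s2 -> N.lxor a b \notin s3) ->
  covered (cap17 s1 s2 s3) (below 64) ->
  2273 <= energy (cap17 s1 s2 s3) (below 64).
Proof.
move=> H1 n1 H2 n2 H3 H12 Hc.
have /allP/(_ s1) := cap17_checked; rewrite mem_filter n1 H1 => /(_ isT).
move=> /allP/(_ s2); rewrite mem_filter n2 H2 => /(_ isT).
move=> /allP/(_ (mask s3, s3)); rewrite mem_filter map_f // andbT => H.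
have: cap17_good s1 s2 s3 (below 64).
  apply: H; apply/eqP/land_mask/allP => v Hv.
  apply/negP => /allpairsP[[a b] [/= Ha Hb E]].
  by have := H12 _ _ Ha Hb; rewrite -E Hv.
by rewrite /cap17_good Hc; case: leqP.
Qed.

Local Open Scope ring_scope.

#[local] Opaque clebsch_pairs clebsch subsets pentad below clebsch4.

(** * Slices of a set along the span of four vectors *)

Lemma addvv k (v : 'rV['F_2]_k) : v + v = 0.
Proof. by apply/rowP => i; rewrite !mxE addrr_pchar2 // pchar_Fp. Qed.

Lemma addvK k (u v : 'rV['F_2]_k) : v + u + u = v.
Proof. by rewrite -addrA addvv addr0. Qed.

Lemma addv_eq0 k (u v : 'rV['F_2]_k) : (u + v == 0) = (u == v).
Proof. by rewrite -(inj_eq (addIr v)) add0r addvK. Qed.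

Definition comb k (x : seq 'rV['F_2]_k) (m : N) : 'rV['F_2]_k :=
  \sum_(i < size x) x`_i *+ N.testbit m (N.of_nat i).

Lemma comb_lxor k (x : seq 'rV['F_2]_k) a b :
  comb x (N.lxor a b) = comb x a + comb x b.
Proof.
rewrite /comb -big_split; apply: eq_bigr => i _; rewrite N.lxor_spec.
case: (N.testbit a _); case: (N.testbit b _) => /=;
  by rewrite ?mulr1n ?mulr0n ?addr0 ?add0r ?addvv.
Qed.

Definition sumfree k (S : {set 'rV['F_2]_k}) :=
  forall a b, a \in S -> b \in S -> a + b \notin S.

Definition slice k (x : seq 'rV['F_2]_k) (T : {set 'rV['F_2]_k}) z : seq N :=
  [seq m <- vertices | z + comb x m \in T].

Definition pentagon k (x : seq 'rV['F_2]_k) (T : {set 'rV['F_2]_k}) :=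
  forall g, g \in pentad -> comb x g \in T.

Lemma size_slice k (x : seq 'rV['F_2]_k) T z v : v \in vertices ->
  size (slice x T (z + comb x v)) = size (slice x T z).
Proof.
move=> Hv; rewrite !size_filter.
under eq_count do rewrite -addrA -comb_lxor.
rewrite -(count_map (N.lxor v) (fun m => z + comb x m \in T)).
suff /seq.permP -> : perm_eq [seq N.lxor v m | m <- vertices] (vertices) by [].
move: Hv; rewrite vertices.unlock; move: v; apply/allP.
by vm_compute.
Qed.

Lemma slice_clebsch k (x : seq 'rV['F_2]_k) (T : {set 'rV['F_2]_k}) z :
  (forall u g, u \in T -> g \in pentad -> u + comb x g \notin T) ->
  slice x T z \in clebsch.
Proof.
move=> H; rewrite clebschE; apply: independent_setsP => a b _ _ Ta Tb; apply/negP => Hg.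
have := H _ _ Ta Hg; rewrite comb_lxor.
by rewrite addrA addvK Tb.
Qed.

(** Here [z] runs over all vectors instead of representatives of translates, so each point of [T] is
    counted for 16 values of [z]. *)
Lemma sum_slice k (x : seq 'rV['F_2]_k) (T : {set 'rV['F_2]_k}) :
  (\sum_z size (slice x T z) = 16 * #|T|)%N.
Proof.
under eq_bigr do rewrite size_filter -sum1_count big_mkcond.
rewrite exchange_big /=.
rewrite (eq_bigr (fun=> #|T|)); last first.
  move=> m _; rewrite -big_mkcond /= (reindex_inj (addIr (comb x m))) /=.
  by under eq_bigl do rewrite addvK; rewrite sum1_card.
by rewrite big_const_seq iter_addn addn0 mulnC count_predT vertices.unlock.
Qed.

Lemma pentad_vertices : {subset pentad <= vertices}.
Proof. by apply/allP; rewrite vertices.unlock; vm_compute. Qed.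

Definition quad_sum k (f : 'rV['F_2]_k -> nat) a b z :=
  (f z + f (z + a)%R + f (z + b)%R + f (z + (a + b))%R)%N.

Lemma quad_sum_shift k (f : 'rV['F_2]_k -> nat) a b z v :
  (forall y, f (y + v) = f y) -> quad_sum f a b (z + v) = quad_sum f a b z.
Proof. by move=> H; rewrite /quad_sum !(addrAC z v) !H. Qed.

(** The sum does not depend on which of its four points is taken as base. Either one value is at
    least 9 and becomes the base, or the total is at most 4 * 8 = 32. *)
Lemma quad_sum_le k (f : 'rV['F_2]_k -> nat) a b :
  (forall z, (9 <= f z)%N -> (quad_sum f a b z <= 33)%N) ->
  forall z, (quad_sum f a b z <= 33)%N.
Proof.
move=> H z.
have Ea : quad_sum f a b (z + a) = quad_sum f a b z.
  by rewrite /quad_sum !addrA addvK; ring.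
have Eb y : quad_sum f a b (y + b) = quad_sum f a b y.
  by rewrite /quad_sum !addrA addvK [y + b + a]addrAC addvK; ring.
have [/H //|h0] := leqP 9 (f z).
have [/H|h1] := leqP 9 (f (z + a)); first by rewrite Ea.
have [/H|h2] := leqP 9 (f (z + b)); first by rewrite Eb.
have [/H|h3] := leqP 9 (f (z + (a + b))); first by rewrite addrA Eb Ea.
by move: h0 h1 h2 h3; rewrite /quad_sum; move: (f _) (f _) (f _) (f _) => *; lia.
Qed.

(** * Sum-free sets with two parallel pentagons *)

(* [pair z] consists of the traces of T = S | (S + g) and U = S & (S + g) on a translate of
   the span.  No point of U lies at difference a, b or a + b = g + c from a
   point of T, so the pairs at z, z + a, z + b, z + a + b are mutually
   compatible and [score_bound] applies. *)
Section Doubled.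
Variables (k : nat) (x : seq 'rV['F_2]_k) (S : {set 'rV['F_2]_k}).
Variables (g a b c : 'rV['F_2]_k).
Hypothesis sfS : sumfree S.
Hypothesis pS : pentagon x S.
Hypothesis pgS : forall h, h \in pentad -> g + comb x h \in S.
Hypotheses (Sa : a \in S) (Sb : b \in S) (Sc : c \in S).
Hypothesis g_abc : g = a + b + c.

Let T := [set v | (v \in S) || (v + g \in S)].
Let U := [set v | (v \in S) && (v + g \in S)].

(** The pentagon in S separates two points of S, or two points of S + g; the parallel pentagon
    separates a point of S from one of S + g. *)
Let T_indep u h : u \in T -> h \in pentad -> u + comb x h \notin T.
Proof.
move=> + Hh; rewrite !inE negb_or => /orP[] Hu; apply/andP; split.
- by apply: sfS; rewrite ?pS.
- by rewrite -addrA [comb _ _ + _]addrC; apply: sfS; rewrite ?pgS.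
- have -> : u + comb x h = (u + g) + (g + comb x h) by rewrite addrA addvK.
  by apply: sfS; rewrite ?pgS.
- by rewrite addrAC; apply: sfS; rewrite ?pS.
Qed.

Let shifted j := forall v, v \in U -> v + j \notin T.

Let shift_S j : j \in S -> shifted j.
Proof.
move=> Sj v; rewrite !inE negb_or => /andP[Hv Hvg].
by apply/andP; split; rewrite 1?(addrAC _ j); apply: sfS.
Qed.

Let shift_ab : shifted (a + b).
Proof.
have -> : a + b = g + c by rewrite g_abc addvK.
move=> v; rewrite !inE negb_or => /andP[Hv Hvg].
apply/andP; split; first by rewrite addrA; apply: sfS.
by rewrite addrA addrAC addvK; apply: sfS.
Qed.

Let pair z := (slice x T z, slice x U z).

Let sub_UT z : {subset slice x U z <= slice x T z}.
Proof.
move=> m; rewrite !mem_filter !inE => /andP[/andP[-> _] ->] //.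
Qed.

Let size_UT z : (size (slice x U z) <= size (slice x T z))%N.
Proof.
apply: uniq_leq_size (@sub_UT z); apply: filter_uniq.
by rewrite vertices.unlock; vm_compute.
Qed.

Let slice_T z : slice x T z \in clebsch.
Proof. exact: slice_clebsch. Qed.

Let subsets_T z : slice x U z \in subsets (slice x T z).
Proof.
have -> : slice x U z = [seq m <- slice x T z | z + comb x m \in U].
  rewrite -filter_predI; apply: eq_filter => m /=; rewrite !inE.
  by case: (_ \in S) (_ \in S) => [] [].
exact: independent_setsP.
Qed.

Let pair_pairs z : pair z \in clebsch_pairs.
Proof.
apply/flattenP; exists [seq (slice x T z, d) | d <- subsets (slice x T z)].
  by apply/mapP; exists (slice x T z).
by apply/mapP; exists (slice x U z).
Qed.

Let disj_shift z j : shifted j -> disj (slice x T z) (slice x U (z + j)).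
Proof.
move=> Hj; apply/allP => m; rewrite !mem_filter => /andP[Hm ->]; rewrite andbT.
apply/negP => /Hj; rewrite addrAC addvK.
by move/negP; apply.
Qed.

Let compat_shift z j : shifted j -> compatible (pair z) (pair (z + j)).
Proof.
move=> Hj; rewrite /compatible /= disj_shift //=.
by have := @disj_shift (z + j) j Hj; rewrite addvK.
Qed.

Let f z := score (pair z).

Let f_shift z m : m \in vertices -> f (z + comb x m) = f z.
Proof. by move=> Hm; rewrite /f /score /= !size_slice. Qed.

Let quad_big z : (9 <= f z)%N -> (quad_sum f a b z <= 33)%N.
Proof.
move=> Hs; have [s5 H5] := clebschP (slice_T z).
have szT : size (slice x T z) = 5%N.
  by move: Hs (size_UT z) s5; rewrite /f /score /=; lia.
have [v Hv Hvg] := H5 szT.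
(* Five independent points are the neighbourhood of some [v]; with the base moved to [v] the trace
   of [T] becomes [pentad], the form required by [score_bound]. *)
rewrite -(@quad_sum_shift _ f a b z (comb x v)); last by move=> y; apply: f_shift.
have ET : slice x T (z + comb x v) = pentad.
  apply: clebsch_pentad (slice_T _) _ => h Hh; rewrite mem_filter.
  have -> : h \in vertices := pentad_vertices Hh.
  rewrite andbT -addrA -comb_lxor.
  by have := Hvg h Hh; rewrite mem_filter => /andP[].
have Hs' : (9 <= f (z + comb x v))%N by rewrite f_shift.
move: (z + comb x v) ET Hs' => {Hs s5 H5 szT v Hv Hvg}z ET Hs.
have sT : size (slice x T z) = 5%N by rewrite ET.
have sU : (4 <= size (slice x U z))%N.
  by move: Hs; rewrite /f /score /= sT (leq_add2l 5 4).
have Hd : slice x U z \in subsets pentad by rewrite -ET; apply: subsets_T.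
have Ep : (pentad, slice x U z) = pair z by rewrite -ET.
have c1 j : shifted j -> compatible (pentad, slice x U z) (pair (z + j)).
  by move=> Hj; rewrite Ep; apply: compat_shift.
have c2 y y' j : y' = y + j -> shifted j -> compatible (pair y) (pair y').
  by move=> -> Hj; apply: compat_shift.
have -> : quad_sum f a b z = (5 + size (slice x U z) + score (pair (z + a)) +
    score (pair (z + b)) + score (pair (z + (a + b))))%N.
  by rewrite /quad_sum /f {1}/score /= sT.
apply: score_bound Hd sU (pair_pairs _) (pair_pairs _) (pair_pairs _) _ _ _ _ _ _.
- exact/c1/shift_S.
- exact/c1/shift_S.
- exact/c1/shift_ab.
- by apply: (c2 _ _ (a + b)) shift_ab; rewrite !addrA addvK.
- by apply: (c2 _ _ b) (shift_S Sb); rewrite addrA.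
- by apply: (c2 _ _ a) (shift_S Sa); rewrite addrA addrAC.
Qed.

(** Each of the four terms of [quad_sum] sums to 16 * (#|T| + #|U|) = 32 * #|S|, whence the 128. *)
Lemma doubled_pentagon_bound : (128 * #|S| <= 33 * 2 ^ k)%N.
Proof.
have TU : (#|T| + #|U| = 2 * #|S|)%N.
  have -> : T = S :|: [set v | v + g \in S] by apply/setP => v; rewrite !inE.
  have -> : U = S :&: [set v | v + g \in S] by apply/setP => v; rewrite !inE.
  rewrite cardsUI mul2n -addnn; congr addn.
  rewrite -!sum1_card (reindex_inj (addIr g)).
  by under eq_bigl do rewrite inE addvK.
have sum_shift (R : {set 'rV_k}) j :
    (\sum_z size (slice x R (z + j)) = 16 * #|R|)%N.
  rewrite -(sum_slice x R).
  by rewrite [RHS](reindex_inj (addIr j) (P := xpredT)).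
have -> : (128 * #|S| = \sum_z quad_sum f a b z)%N.
  rewrite /quad_sum !big_split /= !sum_shift !sum_slice.
  by rewrite -!mulnDr TU -!mulnDl mulnA.
apply: leq_trans (leq_sum _ (fun z _ => quad_sum_le quad_big z)) _.
by rewrite sum_nat_const card_mx card_Fp // mul1n mulnC.
Qed.

End Doubled.

(** * Reduced sum-free sets *)

Definition spans3 k (S : {set 'rV['F_2]_k}) :=
  forall y, y != 0 -> exists a b, [/\ a \in S, b \in S & a + b + y \in S].

Definition rep_number k (S : {set 'rV['F_2]_k}) v := #|[set a in S | a + v \in S]|.
Definition set_energy k (S : {set 'rV['F_2]_k}) := (\sum_v rep_number S v ^ 2)%N.
Definition set_triples k (S : {set 'rV['F_2]_k}) i :=
  (\sum_(a in S) rep_number S (a + i)%R)%N.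

Definition independent k (x : seq 'rV['F_2]_k) n :=
  forall m, m \in below n -> m != 0%num -> comb x m != 0.

Definition lxor_closed n :=
  all (fun a => all (fun b => N.lxor a b \in below n) (below n)) (below n).

Lemma lxor_closedP n a b : lxor_closed n -> a \in below n -> b \in below n ->
  N.lxor a b \in below n.
Proof. by move=> /allP H Ha; have /allP := H a Ha; apply. Qed.

Lemma uniq_below n : uniq (below n).
Proof. by rewrite map_inj_uniq ?iota_uniq //; apply: Nnat.Nat2N.inj. Qed.

Lemma size_below n : size (below n) = n.
Proof. by rewrite size_map size_iota. Qed.

Lemma comb_inj k (x : seq 'rV['F_2]_k) n : lxor_closed n -> independent x n ->
  {in below n &, injective (comb x)}.
Proof.
move=> Hc Hx a b Ha Hb /eqP; rewrite -addv_eq0 -comb_lxor => H.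
apply/eqP; case: (a =P b) => // ab.
have Hab := lxor_closedP Hc Ha Hb.
have ne : N.lxor a b != 0%num by apply/eqP => /N.lxor_eq.
by have := Hx _ Hab ne; rewrite H.
Qed.

(** * Passing from vectors to binary codes *)

Section Basis.
Variables (k : nat) (x : seq 'rV['F_2]_k) (n : nat).
Hypotheses (Hc : lxor_closed n) (Hx : independent x n).

Lemma independent_le : (n <= 2 ^ k)%N.
Proof.
have U : uniq [seq comb x m | m <- below n].
  by rewrite map_inj_in_uniq ?uniq_below //; apply: comb_inj.
have := uniq_leq_size U (fun v _ => mem_enum predT v).
by rewrite size_map size_below -cardT card_mx card_Fp // mul1n.
Qed.

Hypothesis nk : n = (2 ^ k)%N.

Lemma comb_perm : perm_eq (index_enum 'rV['F_2]_k) [seq comb x m | m <- below n].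
Proof.
have U : uniq [seq comb x m | m <- below n].
  by rewrite map_inj_in_uniq ?uniq_below //; apply: comb_inj.
apply: uniq_perm; rewrite ?index_enum_uniq // => v.
rewrite mem_index_enum; apply/esym.
have sz : (size (enum 'rV['F_2]_k) <= size [seq comb x m | m <- below n])%N.
  by rewrite size_map size_below -cardT card_mx card_Fp // mul1n nk.
have sub : {subset [seq comb x m | m <- below n] <= enum 'rV['F_2]_k}.
  by move=> w _; rewrite mem_enum.
by have [_ ->] := uniq_min_size U sub sz; rewrite mem_enum.
Qed.

Lemma sum_comb (F : 'rV['F_2]_k -> nat) :
  (\sum_v F v = \sum_(m <- below n) F (comb x m))%N.
Proof. by rewrite (perm_big _ comb_perm) big_map. Qed.

Variable S : {set 'rV['F_2]_k}.
Let s := [seq m <- below n | comb x m \in S].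

Lemma card_comb : #|S| = size s.
Proof.
by rewrite -sum1_card big_mkcond sum_comb -big_mkcond -big_filter sum1_size.
Qed.

Let in_s a : a \in below n -> (a \in s) = (comb x a \in S).
Proof. by move=> Ha; rewrite mem_filter Ha andbT. Qed.

Lemma rep_number_comb m : m \in below n ->
  rep_number S (comb x m) = rep_count s (mask s) m.
Proof.
move=> Hm; rewrite /rep_number -sum1_card big_mkcond sum_comb -big_mkcond -big_filter sum1_size.
rewrite /rep_count -size_filter -filter_predI; congr size.
apply: eq_in_filter => a Ha /=; rewrite testbit_mask inE -comb_lxor.
by rewrite (in_s (lxor_closedP Hc Ha Hm)) andbC.
Qed.

Lemma energy_comb : set_energy S = energy s (below n).
Proof.
rewrite /set_energy sum_comb /energy sumnE big_map.
by apply: eq_big_seq => m Hm; rewrite rep_number_comb.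
Qed.

Lemma triples_comb m : m \in below n -> set_triples S (comb x m) = triples s m.
Proof.
move=> Hm; rewrite /set_triples /triples sumnE big_map big_filter.
rewrite big_mkcond sum_comb [RHS]big_mkcond; apply: eq_big_seq => a Ha.
by rewrite -comb_lxor (rep_number_comb (lxor_closedP Hc Ha Hm)).
Qed.

Lemma covered_comb : spans3 S -> covered s (below n).
Proof.
move=> HS; apply/allP => y Hy; case Ey : y => [//|p]; rewrite -Ey.
have y0 : y != 0%num by rewrite Ey.
have Hin v : v \in S -> exists2 m, m \in s & v = comb x m.
  move=> Hv; have : v \in [seq comb x m | m <- below n].
    by rewrite -(perm_mem comb_perm) mem_index_enum.
  by case/mapP => m Hm E; exists m => //; rewrite mem_filter Hm -E Hv.
have [u [v [Hu Hv]]] := HS _ (Hx Hy y0).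
have [a Ha ->] := Hin _ Hu; have [b Hb ->] := Hin _ Hv.
rewrite -!comb_lxor => H; rewrite lazy_hasE; apply/hasP; exists a => //.
rewrite lazy_hasE; apply/hasP; exists b => //.
move: (Ha) (Hb); rewrite !mem_filter => /andP[_ Ha'] /andP[_ Hb'].
by rewrite testbit_mask (in_s (lxor_closedP Hc (lxor_closedP Hc Ha' Hb') Hy)).
Qed.

End Basis.

Lemma comb_rcons k (x : seq 'rV['F_2]_k) z m :
  comb (rcons x z) m = comb x m + z *+ N.testbit m (N.of_nat (size x)).
Proof.
rewrite /comb size_rcons big_ord_recr /= nth_rcons ltnn eqxx; congr (_ + _).
by apply: eq_bigr => i _; rewrite nth_rcons ltn_ord.
Qed.

Lemma sumfree0 k (S : {set 'rV['F_2]_k}) : sumfree S -> 0 \notin S.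
Proof. by move=> H; apply/negP => S0; have := H _ _ S0 S0; rewrite addr0 S0. Qed.

Lemma sum_pentad (P : N -> Prop) :
  P 1%num -> P 2%num -> P 4%num -> P 8%num -> P 15%num ->
  forall g, g \in pentad -> P g.
Proof.
move=> P1 P2 P4 P8 P15 g; have -> : pentad = [:: 1; 2; 4; 8; 15]%num by [].
by rewrite !inE => /or4P[|||/orP[]] /eqP ->.
Qed.

(** For distinct u, v in S the nonzero vector u + v is a sum a + b + c of points of S; the pentagon
    is u, v, a, b, c. *)
Lemma exists_pentagon k (S : {set 'rV['F_2]_k}) :
  spans3 S -> (1 < #|S|)%N ->
  exists2 x : seq 'rV['F_2]_k, size x = 4%N & pentagon x S.
Proof.
move=> HS /card_gt1P[u [v [Su Sv uv]]].
have uv0 : u + v != 0 by rewrite addv_eq0.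
have [a [b [Sa Sb Sc]]] := HS _ uv0.
exists [:: u; v; a; b] => //; apply: sum_pentad;
  rewrite /comb !big_ord_recl big_ord0 /= ?mulr1n ?mulr0n ?addr0 ?add0r //.
by rewrite (_ : _ + _ = a + b + (u + v)) // [RHS]addrC !addrA.
Qed.

(** Every nonzero code lies in [pentad] or is a sum of three of its elements. A vanishing
    combination would thus put 0 in S or equate a sum of two points of S with a third. *)
Lemma pentagon_independent k (S : {set 'rV['F_2]_k}) x :
  sumfree S -> pentagon x S -> independent x 16.
Proof.
move=> sfS pS m Hm m0; apply/negP => /eqP Hx.
have /allP/(_ m Hm) : all (fun m => [|| m == 0%num, m \in pentad |
    has (fun g => has (fun h => N.lxor (N.lxor g h) m \in pentad) pentad) pentad])
    (below 16) by vm_compute.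
rewrite (negbTE m0) /=.
case/orP => [/pS|/hasP[g Hg /hasP[h Hh /pS]]].
  by rewrite Hx; apply/negP/sumfree0.
by rewrite !comb_lxor Hx addr0; apply/negP/sfS; apply: pS.
Qed.

Lemma lxor_closed16 : lxor_closed 16. Proof. by vm_compute. Qed.
Lemma lxor_closed32 : lxor_closed 32. Proof. by vm_compute. Qed.
Lemma lxor_closed64 : lxor_closed 64. Proof. by vm_compute. Qed.

Lemma size_vertices : size vertices = 16.
Proof. by rewrite vertices.unlock. Qed.

Section Reduced.
Variables (k : nat) (S : {set 'rV['F_2]_k}) (x : seq 'rV['F_2]_k).
Hypotheses (sfS : sumfree S) (S3 : spans3 S).
Hypotheses (sx : size x = 4%N) (pS : pentagon x S).
Hypothesis dense : (17 * 2 ^ k <= 64 * #|S|)%N.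

Lemma reduced_slice z : slice x S z \in clebsch.
Proof. by apply: slice_clebsch => u g Su Hg; apply: sfS => //; apply: pS. Qed.

(** Five points would form a pentagon parallel to the given one, at a nonzero distance g. As
    [spans3] writes g as a + b + c, the density would be at most 33/128, below 17/64 = 34/128. *)
Lemma reduced_slice_le z : (forall m, m \in vertices -> z != comb x m) ->
  (size (slice x S z) <= 4)%N.
Proof.
move=> Hz; have [s5 H5] := clebschP (reduced_slice z).
rewrite leqNgt; apply/negP => s5'.
have [v Hv Hvg] := H5 (anti_leq (introT andP (conj s5 s5'))).
have g0 : z + comb x v != 0 by rewrite addv_eq0 Hz.
have [a [b [Sa Sb Sc]]] := S3 g0.
have pg h : h \in pentad -> z + comb x v + comb x h \in S.
  by move=> /Hvg; rewrite mem_filter comb_lxor addrA => /andP[].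
have E : z + comb x v = a + b + (a + b + (z + comb x v)).
  by rewrite addrA addvv add0r.
have := doubled_pentagon_bound sfS pS pg Sa Sb Sc E.
by move: dense; move: (2 ^ k)%N #|S| (expn_gt0 2 k) => N s; lia.
Qed.

Lemma reduced_card : (16 * #|S| <= 4 * 2 ^ k + 16)%N.
Proof.
pose W := [seq comb x m | m <- vertices].
rewrite -(sum_slice x S).
have le z : (size (slice x S z) <= 4 + (z \in W))%N.
  have [s5 _] := clebschP (reduced_slice z).
  case: (boolP (z \in W)) => [//|zW]; rewrite addn0.
  by apply: reduced_slice_le => m Hm; apply: contraNneq zW => ->; apply: map_f.
apply: leq_trans (leq_sum _ (fun z _ => le z)) _.
rewrite big_split /= sum_nat_const card_mx card_Fp // mul1n mulnC leq_add2l.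
have -> : (\sum_z (z \in W) = #|W|)%N.
  rewrite -sum1_card [RHS]big_mkcond; apply: eq_bigr => z _.
  by case: (z \in W).
by rewrite (leq_trans (card_size _)) // size_map size_vertices.
Qed.

Lemma reduced_dim : k \in [:: 4; 5; 6]%N.
Proof.
have h1 := independent_le lxor_closed16 (pentagon_independent sfS pS).
(* From 17 * 2^k <= 64 * #|S| <= 16 * 2^k + 64. *)
have h2 : (2 ^ k <= 64)%N by move: reduced_card dense; lia.
have k7 : (k < 7)%N by rewrite ltnNge; apply/negP => /(leq_pexp2l (ltn0Sn 1)); lia.
by move: (k) k7 h1 => [|[|[|[|[|[|[|j]]]]]]].
Qed.

Lemma slice0 : slice x S 0 = pentad.
Proof.
apply: clebsch_pentad (reduced_slice 0) _ => g Hg.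
by rewrite mem_filter add0r pS // pentad_vertices.
Qed.

Lemma exists_outside y n : (n < 2 ^ k)%N ->
  exists z : 'rV['F_2]_k, forall m, m \in below n -> z != comb y m.
Proof.
move=> nk; pose W := [seq comb y m | m <- below n].
have : (0 < #|[predC W]|)%N.
  have := cardC (mem W); rewrite card_mx card_Fp // mul1n.
  have := card_size W; rewrite size_map size_below.
  by move: nk; move: (2 ^ k)%N #|[predC W]| #|W| => N a b; lia.
case/card_gt0P => z; rewrite inE => zW; exists z => m Hm.
by apply: contraNneq zW => ->; apply: map_f.
Qed.

(** The boolean premise, here and in the companion for the high bit, concerns codes only; each
    concrete [n] discharges it by computation. *)
Lemma comb_rcons_low y n z m : size y = n -> m \in below (2 ^ n) ->
  all (fun m => ~~ N.testbit m (N.of_nat n)) (below (2 ^ n)) ->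
  @comb k (rcons y z) m = comb y m.
Proof.
by move=> <- Hm /allP/(_ m Hm)/negbTE; rewrite comb_rcons => ->; rewrite addr0.
Qed.

Lemma comb_rcons_high y n z m : size y = n -> m \in below (2 ^ n) ->
  all (fun m => N.testbit (N.lxor (2 ^ N.of_nat n)%num m) (N.of_nat n) &&
    all (fun i => N.testbit (N.lxor (2 ^ N.of_nat n)%num m) (N.of_nat i)
                  == N.testbit m (N.of_nat i)) (iota 0 n)) (below (2 ^ n)) ->
  @comb k (rcons y z) (N.lxor (2 ^ N.of_nat n)%num m) = comb y m + z.
Proof.
move=> <- Hm /allP/(_ m Hm)/andP[H /allP Hi]; rewrite comb_rcons H; congr (_ + _).
apply: eq_bigr => i _; congr (_ *+ nat_of_bool _); apply/eqP/Hi.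
by rewrite mem_iota add0n ltn_ord.
Qed.

Lemma reduced16 : k = 4 -> #|S| = 5.
Proof.
move=> k4; have Hk : 16 = (2 ^ k)%N by rewrite k4.
rewrite (card_comb lxor_closed16 (pentagon_independent sfS pS) Hk).
have := slice0; rewrite /slice vertices.unlock => E.
by rewrite (eq_filter (a2 := fun m => 0 + comb x m \in S)) ?E // => m; rewrite add0r.
Qed.

Lemma reduced_quad z : (4 <= size (slice x S z))%N ->
  (forall m, m \in vertices -> z != comb x m) -> slice x S z \in clebsch4.
Proof.
move=> H4 Hz; rewrite mem_filter reduced_slice andbT eqn_leq H4 andbT.
exact: reduced_slice_le.
Qed.

Lemma reduced32 : k = 5 ->
  [/\ #|S| = 9, (393 <= set_energy S)%N &
     forall i, i \in S -> (set_triples S i <= 49)%N].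
Proof.
move=> k5; have Hk : 32 = (2 ^ k)%N by rewrite k5.
have [z Hz] := @exists_outside x 16 (ltac:(by rewrite k5)).
have HzV m : m \in vertices -> z != comb x m by rewrite vertices.unlock; apply: Hz.
have low m : m \in vertices -> comb (rcons x z) m = comb x m.
  rewrite vertices.unlock => Hm.
  by apply: (comb_rcons_low z sx Hm); vm_compute.
have high m : m \in vertices -> comb (rcons x z) (N.lxor 16 m) = comb x m + z.
  rewrite vertices.unlock => Hm.
  by apply: (comb_rcons_high z sx Hm); vm_compute.
have V32 : below 32 = vertices ++ [seq N.lxor 16 m | m <- vertices].
  by rewrite vertices.unlock; vm_compute.
have indep : independent (rcons x z) 32.
  move=> m; rewrite V32 mem_cat => /orP[Hm|/mapP[v Hv ->]] m0.
    rewrite low //; apply: (pentagon_independent sfS pS) m0.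
    by rewrite vertices.unlock in Hm.
  by rewrite high // addv_eq0 eq_sym HzV.
have Es : [seq m <- below 32 | comb (rcons x z) m \in S] = cap9 (slice x S z).
  rewrite V32 filter_cat filter_map /cap9 -slice0.
  apply: (f_equal2 (@cat N) _ (f_equal (map (N.lxor 16)) _)).
    by apply: eq_in_filter => m Hm; rewrite add0r low.
  by apply: eq_in_filter => m Hm /=; rewrite high // addrC.
have Ec := card_comb lxor_closed32 indep Hk S; rewrite Es size_cat size_map in Ec.
have Ec' : #|S| = (5 + size (slice x S z))%N by [].
have Hle := reduced_slice_le HzV.
(* Since 17 * 32 / 64 = 8.5, S has at least 9 points, 5 of them in the span. *)
have Hq : slice x S z \in clebsch4.
  apply: reduced_quad => //; move: dense; rewrite Ec' -Hk; lia.
have sz : size (slice x S z) = 4 by move: Hq; rewrite mem_filter => /andP[/eqP].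
have Hcov := covered_comb lxor_closed32 indep Hk S3; rewrite Es in Hcov.
have [He Ht] := cap9_ok Hq Hcov.
split; first by rewrite Ec' sz.
  by rewrite (energy_comb lxor_closed32 indep Hk) Es.
move=> i Si; have : i \in [seq comb (rcons x z) m | m <- below 32].
  by rewrite -(perm_mem (comb_perm lxor_closed32 indep Hk)) mem_index_enum.
case/mapP => m Hm Ei; rewrite Ei (triples_comb lxor_closed32 indep Hk) // Es.
by apply: Ht; rewrite -Es mem_filter Hm -Ei Si.
Qed.

Lemma slice_shift z v : v \in vertices ->
  slice x S (z + comb x v) = [seq m <- vertices | N.lxor v m \in slice x S z].
Proof.
move=> Hv; apply: eq_in_filter => m Hm.
rewrite mem_filter comb_lxor addrA andbC.
have -> // : N.lxor v m \in vertices.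
by move: Hv Hm; rewrite vertices.unlock; apply: lxor_closedP lxor_closed16.
Qed.

(** In dimension 6 the vectors 0, [z1], [z2], [z1 + z2] then represent all four translates of the
    span. *)
Definition transversal z1 z2 := forall m, m \in vertices ->
  [/\ z1 != comb x m, z2 != comb x m & z1 + z2 != comb x m].

Lemma exists_transversal : (32 < 2 ^ k)%N -> exists z1 z2, transversal z1 z2.
Proof.
move=> Hk; have [z1 H1] := @exists_outside x 16 (ltn_trans (isT : 16 < 32)%N Hk).
have [z2 H2] := @exists_outside (rcons x z1) 32 Hk.
exists z1, z2 => m; rewrite vertices.unlock => Hm.
have Hm32 : (m \in below 32) && (N.lxor 16 m \in below 32).
  by move: m Hm; apply/allP; vm_compute.
case/andP: Hm32 => Hm1 Hm2; split; first exact: H1.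
  rewrite -(comb_rcons_low z1 sx Hm); first exact: H2.
  by vm_compute.
rewrite addrC -addv_eq0 -addrA [z1 + _]addrC addv_eq0.
rewrite -(comb_rcons_high z1 sx Hm); first exact: H2.
by vm_compute.
Qed.

Section Transversal.
Variables z1 z2 : 'rV['F_2]_k.
Hypotheses (k6 : k = 6) (Hz : transversal z1 z2).
Let y := rcons (rcons x z1) z2.

Let comb_x c : all (fun i => ~~ N.testbit c (N.of_nat i)) (iota 0 4) -> comb x c = 0.
Proof.
move=> /allP H; rewrite /comb big1 // => i _.
by rewrite (negbTE (H i _)) ?mulr0n // mem_iota /= -[X in (_ < X)%N]sx ltn_ord.
Qed.

Let comb_y c : comb y c = comb x c + z1 *+ N.testbit c 4 + z2 *+ N.testbit c 5.
Proof. by rewrite /y !comb_rcons size_rcons sx. Qed.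

Let comb_y0 m : m \in vertices -> comb y m = comb x m.
Proof.
rewrite vertices.unlock comb_y => Hm.
have /andP[/negbTE-> /negbTE->] : ~~ N.testbit m 4 && ~~ N.testbit m 5.
  by move: m Hm; apply/allP; vm_compute.
by rewrite !mulr0n !addr0.
Qed.

Let comb_y1 m : m \in vertices -> comb y (N.lxor 16 m) = z1 + comb x m.
Proof. by move=> Hm; rewrite comb_lxor (comb_y0 Hm) comb_y comb_x // add0r addr0. Qed.

Let comb_y2 m : m \in vertices -> comb y (N.lxor 32 m) = z2 + comb x m.
Proof. by move=> Hm; rewrite comb_lxor (comb_y0 Hm) comb_y comb_x // !add0r. Qed.

Let comb_y3 m : m \in vertices -> comb y (N.lxor 48 m) = z1 + z2 + comb x m.
Proof. by move=> Hm; rewrite comb_lxor (comb_y0 Hm) comb_y comb_x // add0r. Qed.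

Let V64 : below 64 = vertices ++ [seq N.lxor 16 m | m <- vertices] ++
  [seq N.lxor 32 m | m <- vertices] ++ [seq N.lxor 48 m | m <- vertices].
Proof. by rewrite vertices.unlock; vm_compute. Qed.

Lemma independent64 : independent y 64.
Proof.
move=> m; rewrite V64 !mem_cat.
case/or4P => [Hm|/mapP[v Hv ->]|/mapP[v Hv ->]|/mapP[v Hv ->]] m0.
- rewrite comb_y0 //; apply: (pentagon_independent sfS pS) m0.
  by rewrite vertices.unlock in Hm.
- by rewrite comb_y1 // addv_eq0; have [] := Hz Hv.
- by rewrite comb_y2 // addv_eq0; have [] := Hz Hv.
- by rewrite comb_y3 // addv_eq0; have [] := Hz Hv.
Qed.

Let Hk : 64 = (2 ^ k)%N. Proof. by rewrite k6. Qed.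

Lemma list64 : [seq m <- below 64 | comb y m \in S] =
  cap17 (slice x S z1) (slice x S z2) (slice x S (z1 + z2)).
Proof.
rewrite V64 !filter_cat !filter_map /cap17 -slice0.
apply: (f_equal2 (@cat N) _ (f_equal2 (@cat N) (f_equal (map (N.lxor 16)) _)
  (f_equal2 (@cat N) (f_equal (map (N.lxor 32)) _) (f_equal (map (N.lxor 48)) _)))).
- by apply: eq_in_filter => m Hm; rewrite add0r comb_y0.
- by apply: eq_in_filter => m Hm /=; rewrite comb_y1.
- by apply: eq_in_filter => m Hm /=; rewrite comb_y2.
- by apply: eq_in_filter => m Hm /=; rewrite comb_y3.
Qed.

Lemma card64 : #|S| = (5 + size (slice x S z1) + size (slice x S z2)
  + size (slice x S (z1 + z2)))%N.
Proof.
rewrite (card_comb lxor_closed64 independent64 Hk) list64 !size_cat !size_map.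
by rewrite !addnA.
Qed.

(** Density demands 17 points, and 5 + 4 + 4 + 4 is the most that the slices can hold. *)
Lemma transversal_quads : [/\ slice x S z1 \in clebsch4, slice x S z2 \in clebsch4,
  slice x S (z1 + z2) \in clebsch4 & #|S| = 17].
Proof.
have H z : (forall m, m \in vertices -> z != comb x m) ->
  (size (slice x S z) <= 4)%N by exact: reduced_slice_le.
have h1 : forall m, m \in vertices -> z1 != comb x m by move=> m /Hz[].
have h2 : forall m, m \in vertices -> z2 != comb x m by move=> m /Hz[].
have h3 : forall m, m \in vertices -> z1 + z2 != comb x m by move=> m /Hz[].
have := H _ h1; have := H _ h2; have := H _ h3.
have := dense; rewrite -Hk card64.
have q := reduced_quad; move: (q _ ^~ h1) (q _ ^~ h2) (q _ ^~ h3).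
move: (size _) (size _) (size _) => a b c q1 q2 q3 d l1 l2 l3.
by split; [apply: q1|apply: q2|apply: q3|]; lia.
Qed.

Lemma energy64 : normal (slice x S z1) -> normal (slice x S z2) ->
  (2273 <= set_energy S)%N.
Proof.
move=> n1 n2; have [q1 q2 q3 _] := transversal_quads.
have Hcov := covered_comb lxor_closed64 independent64 Hk S3.
rewrite (energy_comb lxor_closed64 independent64 Hk) list64.
rewrite list64 in Hcov; apply: cap17_ok => // a b.
rewrite !mem_filter => /andP[Ha _] /andP[Hb _]; rewrite negb_and comb_lxor.
by rewrite addrACA sfS.
Qed.

End Transversal.

Lemma reduced64 : k = 6 -> #|S| = 17 /\ (2273 <= set_energy S)%N.
Proof.
move=> k6; have [|z1 [z2 Hz]] := exists_transversal; first by rewrite k6.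
have [q1 q2 _ ->] := transversal_quads k6 Hz; split=> //.
have [v1 V1 n1] := normalize q1; have [v2 V2 n2] := normalize q2.
rewrite -!slice_shift // in n1 n2.
apply: energy64 k6 _ n1 n2 => m Hm.
have sh z v w : (z + comb x v != w) = (z != w + comb x v).
  by rewrite -(inj_eq (addIr (comb x v))) addvK.
have cl a b : a \in vertices -> b \in vertices -> N.lxor a b \in vertices.
  by rewrite vertices.unlock; apply: lxor_closedP lxor_closed16.
rewrite addrACA -comb_lxor !sh -!comb_lxor.
by have [h1 _ _] := Hz _ (cl _ _ Hm V1); have [_ h2 _] := Hz _ (cl _ _ Hm V2);
   have [_ _ h3] := Hz _ (cl _ _ Hm (cl _ _ V1 V2)); split.
Qed.

End Reduced.

(** * Quotients of sum-free sets *)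

Lemma F2P (c : 'F_2) : c = 0 \/ c = 1.
Proof. by case: c => [[|[|//]] i]; [left|right]; apply: val_inj. Qed.

(** The cokernel matrix kills exactly the multiples of [y], over F_2 only 0 and [y]; its column base
    has the same kernel and full rank. *)
Lemma quotient_by k (y : 'rV['F_2]_k) : y != 0 ->
  exists k' (B : 'M['F_2]_(k, k')), [/\ (k' < k)%N, row_full B &
    forall v : 'rV_k, v *m B = 0 -> v = 0 \/ v = y].
Proof.
move=> y0; exists (\rank (cokermx y)), (col_base (cokermx y)).
split; last 1 first.
- move=> v /(congr1 (mulmxr (row_base (cokermx y)))) /=.
  rewrite -mulmxA mulmx_base mul0mx => /eqP; rewrite -submxE => /sub_rVP[c ->].
  by case: (F2P c) => ->; [left; rewrite scale0r|right; rewrite scale1r].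
- rewrite mxrank_coker rank_rV y0 subn1 prednK //.
  by case: k y y0 => // y /eqP[]; apply/rowP => -[].
- exact: col_base_full.
Qed.

(** A relation a + b = c modulo y lifts to a + b + c = 0 or a + b + c = y. Sum-freeness excludes the
    former, and the choice of y outside S + S + S the latter; the dimension drops, so the process
    ends. *)
Lemma reduction k (S : {set 'rV['F_2]_k}) : sumfree S ->
  exists k' (A : 'M['F_2]_(k, k')) (S' : {set 'rV['F_2]_k'}),
    [/\ row_full A, sumfree S', spans3 S' & forall v, v \in S -> v *m A \in S'].
Proof.
elim/ltn_ind: k S => k IH S sfS.
case: (boolP [forall y, (y != 0) ==> [exists a in S, [exists b in S, a + b + y \in S]]]).
  move=> /forallP H; exists k, 1%:M, S; split=> //.
  - by rewrite row_full_unit unitmx1.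
  - move=> y y0; have := implyP (H y) y0.
    by case/exists_inP => a Sa /exists_inP[b Sb Sc]; exists a, b.
  - by move=> v; rewrite mulmx1.
rewrite negb_forall => /existsP[y]; rewrite negb_imply => /andP[y0 Hy].
have [k1 [B [k1k fB HB]]] := quotient_by y0.
pose S1 := [set v *m B | v in S].
have sf1 : sumfree S1.
  move=> _ _ /imsetP[a Sa ->] /imsetP[b Sb ->]; apply/negP => /imsetP[c Sc].
  move=> /eqP; rewrite -mulmxDl -addv_eq0 -mulmxDl => /eqP/HB[/eqP|E].
    by rewrite addv_eq0 => /eqP E; have := sfS _ _ Sa Sb; rewrite E Sc.
  case/negP: Hy; apply/exists_inP; exists a => //; apply/exists_inP; exists b => //.
  by rewrite -E addrA addvv add0r.
have [k' [A [S' [fA sf' s3' H]]]] := IH _ k1k _ sf1.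
exists k', (B *m A), S'; split=> //.
  have h : (A <= B *m A)%MS by rewrite -{1}[A]mul1mx submxMr // sub1mx.
  by rewrite -sub1mx; apply: submx_trans h; rewrite sub1mx.
by move=> v Sv; rewrite mulmxA; apply/H/imset_f.
Qed.

Lemma card_fibre k k' (A : 'M['F_2]_(k, k')) (u : 'rV_k') : row_full A ->
  (#|[set v | v *m A == u]| * 2 ^ k' = 2 ^ k)%N.
Proof.
move=> fA.
have [B BA] : exists B : 'M_(k', k), B *m A = 1%:M.
  by exists (pinvmx A); apply: mulVpmx.
have E (w : 'rV_k') : #|[set v | v *m A == w]| = #|[set v | v *m A == u]|.
  rewrite -!sum1_card (reindex_inj (addIr ((w - u) *m B))) /=.
  apply: eq_bigl => v; rewrite !inE (mulmxDl v) -mulmxA BA mulmx1 addrCA.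
  by rewrite -{2}[w]addr0 (inj_eq (addrI w)) subr_eq0.
have := card_mx 'F_2 1 k; rewrite card_Fp // mul1n => <-.
have -> : #|{: 'rV['F_2]_k}| = (\sum_(w : 'rV_k') #|[set v : 'rV_k | v *m A == w]|)%N.
  rewrite -sum1_card (partition_big (fun v => v *m A) predT) //=.
  by apply: eq_bigr => w _; rewrite -sum1_card; apply: eq_bigl => v; rewrite inE.
under eq_bigr do rewrite E.
by rewrite sum_nat_const card_mx card_Fp // mul1n mulnC.
Qed.

(** * Characters and moments *)

Definition sgn (b : 'F_2) : int := if b == 0 then 1 else -1.

Lemma sgnD a b : sgn (a + b) = sgn a * sgn b.
Proof. by case: (F2P a) => ->; case: (F2P b) => ->; rewrite ?addr0 ?add0r. Qed.

Lemma sgn_sq a : sgn a * sgn a = 1.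
Proof. by case: (F2P a) => ->. Qed.

Definition dot k (w v : 'rV['F_2]_k) : 'F_2 := (w *m v^T) 0 0.
Definition chi k (w v : 'rV['F_2]_k) : int := sgn (dot w v).

Lemma dotC k (w v : 'rV['F_2]_k) : dot w v = dot v w.
Proof. by rewrite /dot -[w *m _]trmxK trmx_mul trmxK mxE. Qed.

Lemma dotDr k (w u v : 'rV['F_2]_k) : dot w (u + v) = dot w u + dot w v.
Proof. by rewrite /dot linearD /= mulmxDr mxE. Qed.

Lemma chiDr k (w u v : 'rV['F_2]_k) : chi w (u + v) = chi w u * chi w v.
Proof. by rewrite /chi dotDr sgnD. Qed.

Lemma chiC k (w v : 'rV['F_2]_k) : chi w v = chi v w.
Proof. by rewrite /chi dotC. Qed.

Lemma chi0r k (w : 'rV['F_2]_k) : chi w 0 = 1.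
Proof. by rewrite /chi /dot trmx0 mulmx0 mxE. Qed.

Lemma chi_sq k (w v : 'rV['F_2]_k) : chi w v * chi w v = 1.
Proof. exact: sgn_sq. Qed.

Lemma chi_sum k (w : 'rV['F_2]_k) (I : Type) (r : seq I) (P : pred I) F :
  chi w (\sum_(i <- r | P i) F i) = \prod_(i <- r | P i) chi w (F i).
Proof. exact: (big_morph (chi w) (chiDr w) (chi0r w)). Qed.

Lemma chi_mul k k' (A : 'M['F_2]_(k, k')) w v :
  chi w (v *m A) = chi (w *m A^T) v.
Proof. by rewrite /chi /dot trmx_mul mulmxA. Qed.

Lemma dot_delta k (v : 'rV['F_2]_k) i : dot (delta_mx 0 i) v = v 0 i.
Proof. by rewrite /dot -rowE !mxE. Qed.

Lemma sum_chi k (v : 'rV['F_2]_k) :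
  \sum_w chi w v = if v == 0 then (2 ^ k)%N%:R else 0.
Proof.
have [->|v0] := eqVneq v 0.
  under eq_bigr do rewrite chi0r.
  by rewrite sumr_const card_mx card_Fp // mul1n.
have [i vi] : exists i, v 0 i != 0.
  apply/existsP; rewrite -negb_forall; apply: contra v0 => /forallP H.
  by apply/eqP/rowP => i; rewrite mxE; apply/eqP/H.
have Hi : chi (delta_mx 0 i) v = -1.
  by rewrite /chi dot_delta /sgn (negbTE vi).
have : \sum_w chi w v = - \sum_w chi w v.
  rewrite {1}(reindex_inj (addIr (delta_mx 0 i))) /= -sumrN.
  by apply: eq_bigr => w _; rewrite chiC chiDr ![chi v _]chiC Hi mulrN1.
by move: (\sum_w _) => s; lia.
Qed.

(** Counts defining words from the generating vectors of the columns, without reference to the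
    runs. *)
Definition zero_sums k n (a : 'I_n -> 'rV['F_2]_k) (i : nat) : nat :=
  #|[set T : {set 'I_n} | (#|T| == i) && (\sum_(j in T) a j == 0)]|.

Definition sign_poly (I : finType) (A : {pred I}) (e : I -> int) : {poly int} :=
  \prod_(j in A) (1 + (e j)%:P * 'X).

Lemma coef_sign_poly (I : finType) (e : I -> int) i :
  (sign_poly predT e)`_i = \sum_(T : {set I} | #|T| == i) \prod_(j in T) e j.
Proof.
rewrite /sign_poly; under eq_bigr do rewrite addrC.
rewrite bigA_distr /= coef_sum big_mkcond [RHS]big_mkcond /=.
rewrite [RHS]big_mkcond.
apply: eq_bigr => T _.
have -> : \prod_j (if j \in T then (e j)%:P * 'X else 1) =
    (\prod_(j in T) e j)%:P * 'X^#|T|.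
  rewrite -big_mkcond /= big_split /= prodr_const rmorph_prod //.
by rewrite coefCM coefXn eq_sym; case: eqP; rewrite ?mulr1 ?mulr0.
Qed.

(** MacWilliams identity: summing the character of a column sum over all [w] detects whether that
    sum is zero. *)
Lemma zero_sums_chi k n (a : 'I_n -> 'rV['F_2]_k) i :
  (2 ^ k)%N%:R * (zero_sums a i)%:R =
  \sum_w (sign_poly predT (fun j => chi w (a j)))`_i.
Proof.
under eq_bigr do rewrite coef_sign_poly.
rewrite exchange_big /=.
under eq_bigr => T _ do [under eq_bigr do rewrite -chi_sum; rewrite sum_chi].
rewrite /zero_sums -sum1_card natr_sum mulr_sumr.
rewrite [LHS]big_mkcond [RHS]big_mkcond /=.
apply: eq_bigr => T _; rewrite inE mulr1.
by do 2!case: eqP.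
Qed.

Section PowerSums.
Variables (I : Type) (e : I -> int).
Hypothesis e1 : forall j, e j * e j = 1.

(** Newton's identities for signs: odd power sums equal [s], even ones equal [n]. *)
Lemma sign_poly_coefs (r : seq I) :
  let p := \prod_(j <- r) (1 + (e j)%:P * 'X) in
  let s := \sum_(j <- r) e j in let n : int := (size r)%:R in
  [/\ p`_0 = 1, p`_1 = s, 2 * p`_2 = s ^+ 2 - n,
     6 * p`_3 = s ^+ 3 - (3 * n - 2) * s &
     24 * p`_4 = s ^+ 4 - (6 * n - 8) * s ^+ 2 + 3 * n ^+ 2 - 6 * n].
Proof.
elim: r => [|j r] /=; first by rewrite !big_nil !coef1 /=; split=> //; ring.
rewrite !big_cons; set p := \prod_(_ <- _) _; set s := \sum_(_ <- _) _.
move=> [p0 p1 p2 p3 p4].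
have c0 : ((1 + (e j)%:P * 'X) * p)`_0 = p`_0.
  by rewrite mulrDl mul1r coefD -mulrA coefCM coefXM mulr0 addr0.
have cS i : ((1 + (e j)%:P * 'X) * p)`_i.+1 = p`_i.+1 + e j * p`_i.
  by rewrite mulrDl mul1r coefD -mulrA coefCM coefXM.
rewrite c0 !cS -[(size r).+1]addn1 natrD.
move: (size r)%:R p2 p3 p4 => n p2 p3 p4.
have E2 : e j ^+ 2 = 1 by rewrite expr2 e1.
have E3 : e j ^+ 3 = e j by rewrite exprS E2 mulr1.
have E4 : e j ^+ 4 = 1 by rewrite exprS E3 e1.
split=> //.
- by rewrite p1 p0; ring.
- rewrite mulrDr p2 p1 sqrrD E2; ring.
- have -> : 6 * (p`_3 + e j * p`_2) = 6 * p`_3 + 3 * e j * (2 * p`_2) by ring.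
  rewrite p3 p2.
  have -> : (e j + s) ^+ 3 = e j ^+ 3 + 3 * e j ^+ 2 * s + 3 * e j * s ^+ 2 + s ^+ 3 by ring.
  rewrite E3 E2; ring.
- have -> : 24 * (p`_4 + e j * p`_3) = 24 * p`_4 + 4 * e j * (6 * p`_3) by ring.
  rewrite p4 p3.
  have -> : (e j + s) ^+ 4 = e j ^+ 4 + 4 * e j ^+ 3 * s + 6 * e j ^+ 2 * s ^+ 2
      + 4 * e j * s ^+ 3 + s ^+ 4 by ring.
  have -> : (e j + s) ^+ 2 = e j ^+ 2 + 2 * e j * s + s ^+ 2 by ring.
  rewrite E4 E3 E2.
  have -> : 4 * e j * (s ^+ 3 - (3 * n - 2) * s) =
      4 * e j * s ^+ 3 - 4 * (3 * n - 2) * e j * s by ring.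
  ring.
Qed.

End PowerSums.

Definition char_sum k n (a : 'I_n -> 'rV['F_2]_k) w : int := \sum_j chi w (a j).
Definition moment k n (a : 'I_n -> 'rV['F_2]_k) i : int := \sum_w char_sum a w ^+ i.

Section Moments.
Variables (k n : nat) (a : 'I_n -> 'rV['F_2]_k).
Let N : int := (2 ^ k)%N%:R.

Let coefs w := sign_poly_coefs (e := fun j => chi w (a j))
  (fun j => chi_sq w (a j)) (index_enum 'I_n).

Let size_enum : (size (index_enum 'I_n))%:R = n%:R :> int.
Proof. by rewrite -[index_enum _]enumT size_enum_ord. Qed.

Let sum_const c : \sum_(w : 'rV['F_2]_k) c = N * c :> int.
Proof. by rewrite sumr_const card_mx card_Fp // mul1n -mulr_natl. Qed.

Lemma zero_sums_moment2 :
  2 * N * (zero_sums a 2)%:R = moment a 2 - N * n%:R.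
Proof.
rewrite -mulrA zero_sums_chi mulr_sumr -sum_const /moment -sumrB.
by apply: eq_bigr => w _; have [_ _ -> _ _] := coefs w; rewrite size_enum.
Qed.

Lemma zero_sums_moment4 :
  24 * N * (zero_sums a 4)%:R =
  moment a 4 - (6 * n%:R - 8) * moment a 2 + N * (3 * n%:R ^+ 2 - 6 * n%:R).
Proof.
rewrite -mulrA zero_sums_chi mulr_sumr -sum_const /moment mulr_sumr -sumrB -big_split.
apply: eq_bigr => w _; have [_ _ _ _ /= ->] := coefs w; rewrite size_enum /char_sum.
by ring.
Qed.

Lemma zero_sums_eq0 i : zero_sums a i = 0%N ->
  forall T : {set 'I_n}, #|T| = i -> \sum_(j in T) a j != 0.
Proof.
move=> /eqP; rewrite cards_eq0 => /eqP/setP H T HT; apply/negP => H0.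
by have := H T; rewrite !inE HT eqxx H0.
Qed.

Lemma zero_sums2_inj : zero_sums a 2 = 0%N -> injective a.
Proof.
move=> /zero_sums_eq0 H i j E; apply/eqP; apply/negPn/negP => ij.
have := H [set i; j]; rewrite cards2 ij => /(_ erefl).
by rewrite big_setU1 ?inE //= big_set1 E addvv eqxx.
Qed.

Lemma zero_sums_sumfree :
  zero_sums a 1 = 0%N -> zero_sums a 2 = 0%N -> zero_sums a 3 = 0%N ->
  sumfree [set a j | j : 'I_n].
Proof.
move=> /zero_sums_eq0 H1 /zero_sums2_inj inj /zero_sums_eq0 H3.
have n0 j : a j != 0 by have := H1 [set j]; rewrite cards1 big_set1; apply.
move=> _ _ /imsetP[i _ ->] /imsetP[j _ ->]; apply/negP => /imsetP[l _ E].
have ij : i != j.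
  by apply: contraTneq (n0 l) => ij; rewrite -E ij addvv eqxx.
have il : i != l.
  apply: contraTneq (n0 j) => il; rewrite -il in E.
  by rewrite -(inj_eq (addrI (a i))) E addr0 eqxx.
have jl : j != l.
  apply: contraTneq (n0 i) => jl; rewrite -jl in E.
  by rewrite -(inj_eq (addIr (a j))) E add0r eqxx.
have := H3 [set i; j; l].
rewrite setUC cardsU1 cards2 !inE negb_or [l == i]eq_sym [l == j]eq_sym il jl ij.
move=> /(_ erefl); rewrite big_setU1 ?inE ?negb_or 1?[l == i]eq_sym 1?[l == j]eq_sym ?il //=.
by rewrite big_setU1 ?inE //= big_set1 E addvv eqxx.
Qed.

Lemma moment2_inj : injective a -> moment a 2 = N * n%:R.
Proof.
move=> inj; have : zero_sums a 2 = 0%N.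
  apply/eqP; rewrite cards_eq0; apply/eqP/setP => T; rewrite !inE.
  apply/negP => /andP[/cards2P[i [j [ij ->]]]].
  by rewrite big_setU1 ?inE //= big_set1 addv_eq0 => /eqP/inj/eqP; apply/negP.
by have := zero_sums_moment2 => + E; rewrite E mulr0; move: (moment a 2) => m; lia.
Qed.

(** Characters of the quotient pull back along [A^T] to distinct characters of the whole space, and
    the remaining ones contribute nonnegative terms. *)
Lemma moment4_proj k' (A : 'M['F_2]_(k, k')) : row_full A ->
  \sum_w' (\sum_j chi w' (a j *m A)) ^+ 4 <= moment a 4.
Proof.
move=> fA.
have inj : injective (fun w' : 'rV_k' => w' *m A^T).
  apply: (can_inj (g := fun w => w *m (pinvmx A)^T)) => w'.
  by rewrite -mulmxA -trmx_mul mulVpmx // trmx1 mulmx1.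
rewrite (eq_bigr (fun w' => char_sum a (w' *m A^T) ^+ 4)); last first.
  by move=> w' _; congr (_ ^+ 4); apply: eq_bigr => j _; rewrite chi_mul.
have <- : \sum_(w in [set w' *m A^T | w' : 'rV_k']) char_sum a w ^+ 4 =
    \sum_w' char_sum a (w' *m A^T) ^+ 4.
  by rewrite big_imset /= => [|u v _ _ /inj].
rewrite /moment big_mkcond; apply: ler_sum => w _.
by case: ifP => // _; rewrite exprn_even_ge0.
Qed.

End Moments.

(** * Energy and triples as sums over characters *)

Section Fourier.
Variables (k : nat) (S : {set 'rV['F_2]_k}).
Let N : int := (2 ^ k)%N%:R.

Lemma parseval (f g : 'rV['F_2]_k -> int) :
  \sum_w (\sum_v f v * chi w v) * (\sum_v g v * chi w v) = N * \sum_v f v * g v.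
Proof.
under eq_bigr do rewrite mulr_suml.
rewrite exchange_big mulr_sumr; apply: eq_bigr => v _ /=.
under eq_bigr do rewrite mulr_sumr.
rewrite exchange_big /= (bigD1 v) //= [X in _ + X]big1 => [|u uv].
  rewrite addr0 (eq_bigr (fun=> f v * g v)) => [|w _].
    by rewrite sumr_const card_mx card_Fp // mul1n -mulr_natl.
  by rewrite mulrACA chi_sq mulr1.
under eq_bigr do rewrite mulrACA -chiDr.
by rewrite -mulr_sumr sum_chi addv_eq0 eq_sym (negbTE uv) mulr0.
Qed.

Let hat w := \sum_(v in S) chi w v.

Let hatE w c : hat w * chi w c = \sum_v ((v + c)%R \in S)%:R * chi w v.
Proof.
rewrite /hat mulr_suml (reindex_inj (addIr c)) /= big_mkcond.
by apply: eq_bigr => v _; rewrite -chiDr addvK; case: (_ \in S); rewrite ?mul1r ?mul0r.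
Qed.

Let hat2 w : hat w ^+ 2 = \sum_v (rep_number S v)%:R * chi w v.
Proof.
rewrite expr2 {1}/hat mulr_suml.
under eq_bigr => b _ do rewrite mulrC hatE.
rewrite exchange_big /=; apply: eq_bigr => v _; rewrite -mulr_suml; congr (_ * _).
rewrite /rep_number -sum1_card natr_sum big_mkcond [RHS]big_mkcond /=.
apply: eq_bigr => b _; rewrite inE addrC.
by case: (b \in S) => //=; case: (_ \in S).
Qed.

(** Parseval for the square of the transform, which is the transform of the representation
    numbers. *)
Lemma sum_hat4 : \sum_w hat w ^+ 4 = N * (set_energy S)%:R.
Proof.
rewrite (eq_bigr (fun w => (\sum_v (rep_number S v)%:R * chi w v) *
                           (\sum_v (rep_number S v)%:R * chi w v))).
  by rewrite parseval /set_energy natr_sum; under [in RHS]eq_bigr do rewrite natrX expr2.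
by move=> w _; rewrite -hat2 -exprD.
Qed.

Lemma sum_hat3 i : \sum_w hat w ^+ 3 * chi w i = N * (set_triples S i)%:R.
Proof.
rewrite (eq_bigr (fun w => (\sum_v (rep_number S v)%:R * chi w v) *
   (\sum_v ((v + i)%R \in S)%:R * chi w v))).
  rewrite parseval /set_triples natr_sum; congr (_ * _).
  rewrite (reindex_inj (addIr i)) [RHS]big_mkcond /=; apply: eq_bigr => v _.
  by rewrite addvK; case: (v \in S); rewrite ?mulr1 ?mulr0.
by move=> w _; rewrite -hat2 -hatE mulrA -exprSr.
Qed.

(* x^4 lies above its tangent at [P * hat w]; summing over w needs only the fourth
   moment of [S] and its cubic correlations with the deficiencies [P - m v]. *)
Lemma fourth_power_tangent (m : 'rV['F_2]_k -> int) (P : int) :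
  (forall v, v \notin S -> m v = 0) ->
  P ^+ 4 * (N * (set_energy S)%:R)
    - 4 * P ^+ 3 * (N * \sum_(v in S) (P - m v) * (set_triples S v)%:R)
  <= \sum_w (\sum_v m v * chi w v) ^+ 4.
Proof.
move=> mS; rewrite -sum_hat4 !mulr_sumr.
have -> : \sum_(v in S) 4 * P ^+ 3 * (N * ((P - m v) * (set_triples S v)%:R)) =
  \sum_w 4 * P ^+ 3 * hat w ^+ 3 * (P * hat w - \sum_v m v * chi w v).
  have E w : P * hat w - \sum_v m v * chi w v = \sum_(v in S) (P - m v) * chi w v.
    rewrite /hat mulr_sumr [in RHS](eq_bigr (fun v => P * chi w v - m v * chi w v)).
      rewrite sumrB; congr (_ - _); rewrite [RHS]big_mkcond; apply: eq_bigr => v _.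
      by case: ifPn => // /mS ->; rewrite mul0r.
    by move=> v _; rewrite mulrBl.
  under [RHS]eq_bigr do rewrite E mulr_sumr.
  rewrite exchange_big /=; apply: eq_bigr => v _.
  have -> : N * ((P - m v) * (set_triples S v)%:R) =
      (P - m v) * (N * (set_triples S v)%:R).
    by ring.
  rewrite -sum_hat3 !mulr_sumr; apply: eq_bigr => w _; ring.
rewrite -sumrB; apply: ler_sum => w _.
move: (hat w) (\sum_v _) => h s.
rewrite -subr_ge0.
have -> : s ^+ 4 - (P ^+ 4 * h ^+ 4 - 4 * P ^+ 3 * h ^+ 3 * (P * h - s)) =
  (s - P * h) ^+ 2 * ((s + P * h) ^+ 2 + 2 * (P * h) ^+ 2) by ring.
by rewrite mulr_ge0 ?sqr_ge0 // addr_ge0 ?sqr_ge0 // mulr_ge0 ?sqr_ge0.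
Qed.

End Fourier.

(** The four unit vectors and, at index 4, their sum: generators of the columns of X0 under I =
    ABCDE. *)
Definition pent (i : 'I_5) : 'rV['F_2]_4 :=
  \row_(l < 4) ((i == l :> nat) || (i == 4 :> nat))%:R.

Lemma comb_matrix k (x : seq 'rV['F_2]_k) m : size x = 4%N ->
  comb x m = (\row_(l < 4) (N.testbit m (N.of_nat l))%:R) *m (\matrix_(l < 4) x`_l).
Proof.
move=> sx; rewrite /comb sx mulmx_sum_row; apply: eq_bigr => l _.
by rewrite rowK mxE; case: (N.testbit _ _); rewrite ?scale1r ?scale0r.
Qed.

Lemma pentagon_coordinates (S : {set 'rV['F_2]_4}) x :
  sumfree S -> size x = 4%N -> pentagon x S -> #|S| = 5 ->
  exists2 B, B \in unitmx & forall v, v \in S -> exists i, v *m B = pent i.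
Proof.
move=> sfS sx pS S5; pose B := \matrix_(l < 4) x`_l.
have indep := pentagon_independent sfS pS.
have Bu : B \in unitmx.
  rewrite -row_full_unit -sub1mx; apply/row_subP => l.
  have : row l 1%:M \in [seq comb x m | m <- below 16].
    by rewrite -(perm_mem (comb_perm lxor_closed16 indep _)) ?mem_index_enum.
  by case/mapP => m _ ->; rewrite comb_matrix // submxMl.
exists (invmx B); first by rewrite unitmx_inv.
move=> v Sv; have : v \in [seq comb x m | m <- below 16].
  by rewrite -(perm_mem (comb_perm lxor_closed16 indep _)) ?mem_index_enum.
case/mapP => m Hm Ev; have Hg : m \in pentad.
  by rewrite -(slice0 sfS pS) mem_filter add0r -Ev Sv vertices.unlock.
rewrite Ev comb_matrix // mulmxK //; move: m Hg {Hm Ev}; apply: sum_pentad.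
- by exists 0; apply/rowP; case=> -[|[|[|[|//]]]] i; rewrite !mxE.
- by exists (@Ordinal 5 1 isT); apply/rowP; case=> -[|[|[|[|//]]]] i; rewrite !mxE.
- by exists (@Ordinal 5 2 isT); apply/rowP; case=> -[|[|[|[|//]]]] i; rewrite !mxE.
- by exists (@Ordinal 5 3 isT); apply/rowP; case=> -[|[|[|[|//]]]] i; rewrite !mxE.
- by exists (@Ordinal 5 4 isT); apply/rowP; case=> -[|[|[|[|//]]]] i; rewrite !mxE.
Qed.

Lemma pushforward k k' (A : 'M['F_2]_(k, k')) n (a : 'I_n -> 'rV_k) w :
  \sum_j chi w (a j *m A) =
  \sum_v #|[set j | a j *m A == v]|%:R * chi w v.
Proof.
rewrite (partition_big (fun j => a j *m A) predT) //=; apply: eq_bigr => v _.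
rewrite (eq_bigr (fun=> chi w v)) => [|j /eqP -> //].
rewrite sumr_const mulr_natl; congr (_ *+ _).
by apply: eq_card => j; rewrite inE.
Qed.

Section Competitor.
Variables (k n : nat) (a : 'I_n -> 'rV['F_2]_k).
Hypotheses (a1 : zero_sums a 1 = 0%N) (a2 : zero_sums a 2 = 0%N)
  (a3 : zero_sums a 3 = 0%N).
Hypothesis dense : (17 * 2 ^ k <= 64 * n)%N.

(* 393 and 2273 bound from below the energies of reduced sets in dimensions 5 and 6;
   196 = 4 * 49, where 49 bounds the number of triples with a given sum in the set. *)
Lemma competitor_structure :
  [\/ 2 * n%:R ^+ 4 <= moment a 4,
      exists2 A : 'M['F_2]_(k, 4), row_full A &
        forall j, exists i, a j *m A = pent i,
      exists P : nat, [/\ (2 ^ k = 32 * P)%N, (n <= 9 * P)%N &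
        32 * (393 * P%:R ^+ 4 - 196 * P%:R ^+ 3 * (9 * P%:R - n%:R)) <= moment a 4] |
      exists P : nat, [/\ (2 ^ k = 64 * P)%N, (n = 17 * P)%N &
        64 * 2273 * P%:R ^+ 4 <= moment a 4]].
Proof.
have inj := zero_sums2_inj a2.
have [k' [A [S [fA sfS S3 aS]]]] := reduction (zero_sums_sumfree a1 a2 a3).
have {}aS j : a j *m A \in S by apply/aS/imset_f.
pose m v := #|[set j | a j *m A == v]|.
pose P := #|[set v : 'rV_k | v *m A == 0]|.
have HP : (P * 2 ^ k' = 2 ^ k)%N by apply: card_fibre.
have P0 : (0 < P)%N by move: (expn_gt0 2 k); rewrite -HP; case: (P).
(* The columns are distinct, so they take a value at most as often as its fibre has points. *)
have mP v : (m v <= P)%N.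
  have : (P * 2 ^ k' == #|[set u : 'rV_k | u *m A == v]| * 2 ^ k')%N.
    by rewrite HP card_fibre.
  rewrite eqn_pmul2r ?expn_gt0 // => /eqP ->.
  rewrite /m -(card_imset _ inj) subset_leq_card //.
  by apply/subsetP => _ /imsetP[j Hj ->]; rewrite !inE in Hj *.
have mS v : v \notin S -> m v = 0%N.
  move=> vS; apply/eqP; rewrite cards_eq0; apply/eqP/setP => j; rewrite !inE.
  by apply: contraNF vS => /eqP <-.
have sum_m : n = (\sum_(v in S) m v)%N.
  transitivity #|'I_n|; first by rewrite card_ord.
  rewrite -sum1_card (partition_big (fun j => a j *m A) (mem S)) //=.
  by apply: eq_bigr => v _; rewrite /m -sum1_card; apply: eq_bigl => j; rewrite inE.
have nP : (n <= P * #|S|)%N.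
  by rewrite sum_m mulnC -sum_nat_const; apply: leq_sum.
have dense' : (17 * 2 ^ k' <= 64 * #|S|)%N.
  rewrite -(leq_pmul2l P0) mulnCA HP (leq_trans dense) // mulnCA.
  by rewrite leq_pmul2l.
have low := moment4_proj a fA.
have [S1|S1] := leqP #|S| 1.
  (* Already k' = 2 would need 17 * 4 = 68 <= 64, while for k' = 0 the set would contain 0. *)
  have k1 : k' = 1%N.
    have : (0 < #|S|)%N.
      by move: dense'; case: #|S| => //; rewrite muln0 leqn0 muln_eq0 expn_eq0.
    case/card_gt0P => v Sv.
    move: dense'; have : (64 * #|S| <= 64)%N by rewrite -{2}[64%N]muln1 leq_pmul2l.
    case: k' v S sfS Sv {S3 aS A fA m P HP P0 mP mS sum_m nP low S1} => [|[|k']] //.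
      move=> v S sfS Sv; have := sumfree0 sfS.
      by rewrite (_ : 0 = v) ?Sv //; apply/rowP => -[].
    move=> _ S _ _ h; rewrite leqNgt => /negP[]; rewrite (leq_ltn_trans h) //.
    by rewrite !expnS; move: (expn_gt0 2 k'); lia.
  (* All columns have the same image, so each of the two characters contributes n^4. *)
  constructor 1; apply: le_trans low.
  rewrite (eq_bigr (fun=> n%:R ^+ 4)) => [|w _].
    by rewrite sumr_const card_mx card_Fp // mul1n k1 expn1 mulr_natl.
  have [S0|/card_gt0P[v Sv]] := posnP #|S|.
    by move: dense'; rewrite S0 muln0 leqn0 muln_eq0 expn_eq0.
  have Ev j : a j *m A = v by apply: (card_le1_eqP S1).
  under eq_bigr do rewrite Ev.
  have c4 : chi w v ^+ 4 = 1 by rewrite (exprM _ 2 2) (expr2 (chi w v)) chi_sq expr1n.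
  by rewrite sumr_const card_ord -[chi w v *+ n]mulr_natl exprMn c4 mulr1.
have [x sx pS] := exists_pentagon S3 S1.
have tan := fourth_power_tangent (m := fun v => (m v)%:R) P%:R (fun v vS => congr1 _ (mS v vS)).
have Epush : \sum_w (\sum_j chi w (a j *m A)) ^+ 4 =
    \sum_w (\sum_v (m v)%:R * chi w v) ^+ 4.
  by apply: eq_bigr => w _; rewrite pushforward.
rewrite Epush in low; have {tan}low := le_trans tan low.
have : k' \in [:: 4; 5; 6]%N by apply: (reduced_dim sfS S3 (x := x)).
rewrite !inE => /or3P[]/eqP k'E.
- constructor 2.
  have S5 := reduced16 sfS pS k'E; subst k'.
  have [B Bu HB] := pentagon_coordinates sfS sx pS S5.
  exists (A *m B); first by rewrite /row_full mxrankMfree ?row_free_unit.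
  by move=> j; rewrite mulmxA; apply: HB.
- constructor 3; exists P.
  have [S9 He Ht] := reduced32 sfS S3 sx pS dense' k'E.
  move: HP nP; rewrite S9 k'E => HP nP; split; [lia|lia|].
  apply: le_trans low; have -> : (2 ^ k')%N%:R = 32 :> int by rewrite k'E.
  have : \sum_(v in S) (P%:R - (m v)%:R) * (set_triples S v)%:R <=
      49 * (9 * P%:R - n%:R) :> int.
    have -> : 9 * P%:R - n%:R = \sum_(v in S) (P%:R - (m v)%:R) :> int.
      by rewrite sumrB sumr_const S9 -natr_sum -sum_m mulr_natl.
    rewrite mulr_sumr; apply: ler_sum => v Sv; rewrite mulrC ler_wpM2r //.
      by rewrite subr_ge0 ler_nat.
    by rewrite (ler_nat _ _ 49) Ht.
  move: (\sum_(v in S) _) (set_energy S) He => s E He Hs.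
  have HE : 393 <= E%:R :> int by rewrite (ler_nat _ 393).
  have P4 : 0 <= P%:R ^+ 4 :> int by rewrite exprn_ge0.
  have P3 : 0 <= P%:R ^+ 3 :> int by rewrite exprn_ge0.
  move: (P%:R ^+ 4) (P%:R ^+ 3) (9 * P%:R - n%:R) P4 P3 Hs => p4 p3 L P4 P3 Hs.
  have h4 := ler_wpM2l P4 HE; have h3 := ler_wpM2l P3 Hs.
  by move: (E%:R) h4 h3 {HE} => e h4 h3; lia.
- constructor 4; exists P.
  have [S17 He] := reduced64 sfS S3 sx pS dense' k'E.
  move: HP nP; rewrite S17 k'E => HP nP.
  have En : n = (17 * P)%N by move: dense; rewrite -HP; lia.
  split; [lia|by []|].
  apply: le_trans low; have -> : (2 ^ k')%N%:R = 64 :> int by rewrite k'E.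
  (* As n = 17 P, every fibre over S is full. *)
  have -> : \sum_(v in S) (P%:R - (m v)%:R) * (set_triples S v)%:R = 0 :> int.
    have Z : (\sum_(v in S) (P - m v) = 0)%N.
      rewrite sumnB // sum_nat_const S17 -sum_m En; lia.
    rewrite big1 // => v Sv; move/eqP: Z; rewrite sum_nat_eq0 => /forall_inP/(_ v Sv).
    rewrite subn_eq0 => Pm; have -> : m v = P by apply/eqP; rewrite eqn_leq mP Pm.
    by rewrite subrr mul0r.
  rewrite !mulr0 subr0.
  have HE : 2273 <= (set_energy S)%:R :> int by rewrite (ler_nat _ 2273).
  have P4 : 0 <= P%:R ^+ 4 :> int by rewrite exprn_ge0.
  have h4 := ler_wpM2l P4 HE.
  by move: (P%:R ^+ 4) (set_energy S)%:R h4 => p4 e h4; lia.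
Qed.

End Competitor.

(** * Projections of X *)

(* Coordinates of the column of X that is generated from column [x.1] of X0 and has
   position [x.2] among the 2^l columns so generated. *)
Definition colvec l (x : 'I_5 * 'rV['F_2]_l) : 'rV['F_2]_(4 + l) :=
  row_mx (pent x.1) x.2.

Lemma chi_row_mx l w1 (w2 : 'rV['F_2]_l) x :
  chi (row_mx w1 w2) (colvec x) = chi w1 (pent x.1) * chi w2 x.2.
Proof. by rewrite /chi /dot /colvec tr_row_mx mul_row_col mxE sgnD. Qed.

Lemma sum_row_mx (R : nmodType) m l (F : 'rV['F_2]_(m + l) -> R) :
  \sum_w F w = \sum_w1 \sum_w2 F (row_mx w1 w2).
Proof.
rewrite pair_big /= (reindex (fun p : 'rV_m * 'rV_l => row_mx p.1 p.2)) //.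
exists (fun w => (lsubmx w, rsubmx w)) => [[w1 w2] _|w _] /=.
  by rewrite row_mxKl row_mxKr.
by rewrite hsubmxK.
Qed.

Lemma sgn_natr n : sgn n%:R = if odd n then -1 else 1.
Proof.
elim: n => // n IH; rewrite mulrS sgnD IH /=.
by case: (odd n).
Qed.

Definition bit_row (m : N) : 'rV['F_2]_4 := \row_(l < 4) (N.testbit m (N.of_nat l))%:R.

Definition pent_sign (m : N) (i : nat) : int :=
  if odd (count (fun l => N.testbit m (N.of_nat l) && ((i == l) || (i == 4))) (iota 0 4))
  then -1 else 1.

Lemma chi_bit_row m (i : 'I_5) : chi (bit_row m) (pent i) = pent_sign m i.
Proof.
rewrite /pent_sign /chi /dot mxE -sgn_natr -sum1_count -[iota 0 4]/(index_iota 0 4).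
rewrite [in RHS]big_mkcond big_mkord natr_sum; congr sgn; apply: eq_bigr => l _.
by rewrite !mxE -natrM mulnb; case: (_ && _).
Qed.

Lemma bit_row_perm : perm_eq (index_enum 'rV['F_2]_4) [seq bit_row m | m <- below 16].
Proof.
have U : uniq [seq bit_row m | m <- below 16].
  rewrite map_inj_in_uniq ?uniq_below // => a b Ha Hb /rowP E.
  have {}E l : (l < 4)%N -> N.testbit a (N.of_nat l) = N.testbit b (N.of_nat l).
    move=> Hl; have := E (Ordinal Hl); rewrite !mxE /=.
    by do 2!case: (N.testbit _ _).
  have /allP/(_ a Ha)/allP/(_ b Hb)/implyP H : all (fun a => all (fun b =>
      all (fun l => N.testbit a (N.of_nat l) == N.testbit b (N.of_nat l)) (iota 0 4)
      ==> (a == b)) (below 16)) (below 16) by vm_compute.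
  by apply/eqP/H/allP => l; rewrite mem_iota => /E/eqP.
apply: uniq_perm; rewrite ?index_enum_uniq // => v.
rewrite mem_index_enum; apply/esym.
have sz : (size (enum 'rV['F_2]_4) <= size [seq bit_row m | m <- below 16])%N.
  by rewrite size_map size_below -cardT card_mx card_Fp.
have sub : {subset [seq bit_row m | m <- below 16] <= enum 'rV['F_2]_4}.
  by move=> w _; rewrite mem_enum.
by have [_ ->] := uniq_min_size U sub sz; rewrite mem_enum.
Qed.

(** The only relation among the five vectors has length 5, so just the monomials x_i^4 and 6 x_i^2
    x_j^2 survive the sum over [w]. The proof expands all sixteen terms. *)
Lemma chi_pent_sum (x : 'I_5 -> int) :
  \sum_(w : 'rV['F_2]_4) (\sum_i chi w (pent i) * x i) ^+ 4 =
  16 * (3 * (\sum_i x i ^+ 2) ^+ 2 - 2 * \sum_i x i ^+ 4).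
Proof.
rewrite (perm_big _ bit_row_perm) big_map.
under eq_bigr do under eq_bigr do rewrite chi_bit_row.
rewrite [below 16]/= !big_cons big_nil !big_ord_recl !big_ord0.
rewrite /= /pent_sign /=.
move: (x _) (x _) (x _) (x _) (x _) => x0 x1 x2 x3 x4.
ring.
Qed.

(** * Word counts of complementary projections *)

Section Patterns.
Variables (l : nat).
Hypothesis l0 : (0 < l)%N.
Let X : finType := ('I_5 * 'rV['F_2]_l)%type.
Let W : int := (2 ^ l)%N%:R.

Definition fibre n (g : 'I_n -> 'I_5 * 'rV['F_2]_l) i := #|[set j | (g j).1 == i]|.

Definition complementary n u (g : 'I_n -> X) (h : 'I_u -> X) :=
  [/\ injective g, injective h & forall x, (x \in codom h) = (x \notin codom g)].

Section Complement.
Variables (n u : nat) (g : 'I_n -> X) (h : 'I_u -> X).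
Hypothesis gh : complementary g h.

Lemma big_complementary (R : Type) (idx : R) (op : Monoid.com_law idx) (F : X -> R) :
  op (\big[op/idx]_j F (g j)) (\big[op/idx]_j F (h j)) = \big[op/idx]_x F x.
Proof.
have [ginj hinj Hc] := gh.
have E m (k : 'I_m -> X) : injective k ->
    \big[op/idx]_j F (k j) = \big[op/idx]_(x in [set k j | j : 'I_m]) F x.
  by move=> kinj; rewrite big_imset //= => i j _ _ /kinj.
rewrite (E _ _ ginj) (E _ _ hinj) [RHS](bigID (mem [set g j | j : 'I_n])) /=.
congr (op _ _); apply: eq_bigl => x.
have imc m (k : 'I_m -> X) : (x \in [set k j | j : 'I_m]) = (x \in codom k).
  by apply/imsetP/codomP => [[j _ ->]|[j ->]]; exists j.
by rewrite !imc Hc.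
Qed.

Lemma sum_fibre (m : nat) (k : 'I_m -> X) (F : 'I_5 -> int) :
  \sum_j F (k j).1 = \sum_i (fibre k i)%:R * F i.
Proof.
rewrite (partition_big (fun j => (k j).1) predT) //=; apply: eq_bigr => i _.
rewrite (eq_bigr (fun=> F i)) => [|j /eqP -> //].
rewrite sumr_const mulr_natl; congr (_ *+ _).
by apply: eq_card => j; rewrite inE.
Qed.

Lemma fibre_compl i : (fibre g i)%:R = W - (fibre h i)%:R :> int.
Proof.
have ind m (k : 'I_m -> X) : (fibre k i)%:R = \sum_j (((k j).1 == i)%:R : int).
  by rewrite (sum_fibre k (fun i' => (i' == i)%:R)) (bigD1 i) //= eqxx mulr1 big1
    ?addr0 // => i' /negbTE->; rewrite mulr0.
rewrite !ind; apply/eqP; rewrite eq_sym subr_eq; apply/eqP.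
rewrite (big_complementary _ (fun x => ((x.1 == i)%:R : int))).
rewrite -(pair_big predT predT (fun i' _ => (i' == i)%:R)) /= (bigD1 i) //= eqxx.
rewrite [X in _ + X]big1 ?addr0 => [|i' ii]; last by rewrite (negbTE ii) big1.
by rewrite sumr_const card_mx card_Fp // mul1n.
Qed.

Lemma char_sum_row m (k : 'I_m -> X) w1 :
  char_sum (fun j => colvec (k j)) (row_mx w1 0) = \sum_i chi w1 (pent i) * (fibre k i)%:R.
Proof.
rewrite /char_sum.
under eq_bigr do rewrite chi_row_mx [chi 0 _]chiC chi0r mulr1.
rewrite (sum_fibre k (fun i => chi w1 (pent i))).
by apply: eq_bigr => i _; rewrite mulrC.
Qed.

Lemma sum_chi_left (w2 : 'rV['F_2]_l) : w2 != 0 -> \sum_v chi w2 v = 0.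
Proof.
by move=> w20; under eq_bigr do rewrite chiC; rewrite sum_chi (negbTE w20).
Qed.

(** For [w2 != 0] the character sum over all of X vanishes, so the two parts have opposite sums and
    equal fourth powers. Only [w2 = 0] remains, where the sums depend on the class sizes alone. *)
Lemma moment4_complementary :
  moment (fun j => colvec (g j)) 4 - moment (fun j => colvec (h j)) 4 =
  16 * (3 * (\sum_i (W - (fibre h i)%:R) ^+ 2) ^+ 2 - 2 * \sum_i (W - (fibre h i)%:R) ^+ 4)
  - 16 * (3 * (\sum_i (fibre h i)%:R ^+ 2) ^+ 2 - 2 * \sum_i (fibre h i)%:R ^+ 4).
Proof.
rewrite -!chi_pent_sum /moment !sum_row_mx -!sumrB; apply: eq_bigr => w1 _.
rewrite -sumrB (bigD1 0) //= big1 => [|w2 w20].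
  rewrite addr0 !char_sum_row; congr (_ ^+ 4 - _).
  by apply: eq_bigr => i _; rewrite fibre_compl.
have : char_sum (fun j => colvec (g j)) (row_mx w1 w2) +
       char_sum (fun j => colvec (h j)) (row_mx w1 w2) = 0.
  rewrite /char_sum (big_complementary _ (fun x => chi (row_mx w1 w2) (colvec x))).
  under eq_bigr do rewrite chi_row_mx.
  rewrite -(pair_big predT predT (fun i v => chi w1 (pent i) * chi w2 v)) /=.
  by rewrite big1 // => i _; rewrite -mulr_sumr sum_chi_left ?mulr0.
by move=> /eqP; rewrite addr_eq0 => /eqP ->; rewrite (exprM _ 2 2) sqrrN -exprM subrr.
Qed.

End Complement.

(* As p and q have constant term 1, p * F = q * G makes the lowest coefficients of F
   and G agree. *)
Lemma eq_coef_lex (p q F G : {poly int}) i :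
  p`_0 = 1 -> q`_0 = 1 -> p * F = q * G -> (forall j, (j < i)%N -> G`_j = 0) ->
  (forall j, (j < i)%N -> F`_j = 0) /\ F`_i = G`_i.
Proof.
move=> p0 q0 E HG.
have HF m : (m <= i)%N -> (forall j, (j < m)%N -> F`_j = 0) -> F`_m = G`_m.
  move=> mi Hm; have := congr1 (fun r : {poly int} => r`_m) E.
  have low (r H : {poly int}) : (forall j, (j < m)%N -> H`_j = 0) ->
      (r * H)`_m = r`_0 * H`_m.
    move=> H0; rewrite coefM big_ord_recl subn0 big1 ?addr0 // => j _.
    by rewrite H0 ?mulr0 // lift0 ltn_subrL /= (leq_trans _ (ltn_ord j)).
  by rewrite !low ?p0 ?q0 ?mul1r // => j jm; apply: HG; apply: leq_trans mi.
have F0 : forall j, (j < i)%N -> F`_j = 0.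
  elim/ltn_ind => j IH ji; rewrite (HF j (ltnW ji)) ?HG // => m mj.
  by rewrite IH // (ltn_trans mj).
by split=> //; apply: HF.
Qed.

Lemma coef_sign_poly_opp (I : finType) (e : I -> int) i :
  (sign_poly predT (fun j => - e j))`_i = (-1) ^+ i * (sign_poly predT e)`_i.
Proof.
rewrite !coef_sign_poly mulr_sumr; apply: eq_bigr => T /eqP <-.
by rewrite prodrN.
Qed.

Definition row_poly n (g : 'I_n -> X) w := sign_poly predT (fun j => chi w (colvec (g j))).
Definition row_poly_opp n (g : 'I_n -> X) w :=
  sign_poly predT (fun j => - chi w (colvec (g j))).

Lemma coef_row_poly_opp n (g : 'I_n -> X) w i :
  (row_poly_opp g w)`_i = (-1) ^+ i * (row_poly g w)`_i.
Proof. exact: coef_sign_poly_opp. Qed.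

Lemma zero_sums_row_poly n (g : 'I_n -> X) i :
  (2 ^ (4 + l))%N%:R * (zero_sums (fun j => colvec (g j)) i)%:R =
  \sum_w (row_poly g w)`_i.
Proof. exact: zero_sums_chi. Qed.

Lemma row_polyM n (g : 'I_n -> X) w :
  row_poly g w * row_poly_opp g w = (1 - 'X^2) ^+ n.
Proof.
rewrite /row_poly /row_poly_opp /sign_poly -big_split /=.
rewrite (eq_bigr (fun=> 1 - 'X^2)) => [|j _]; first by rewrite prodr_const card_ord.
rewrite polyCN mulNr mulrC -subr_sqr expr1n exprMn -polyC_exp expr2 chi_sq.
by rewrite polyC1 mul1r.
Qed.

(** In each of the five classes half of the 2^l columns get either sign, and opposite signs pair up
    to 1 - X^2. *)
Lemma full_poly (w1 : 'rV_4) (w2 : 'rV_l) : w2 != 0 ->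
  \prod_(x : X) (1 + (chi (row_mx w1 w2) (colvec x))%:P * 'X) =
  (1 - 'X^2) ^+ (5 * 2 ^ l.-1).
Proof.
move=> w20.
have [v v1] : exists v, chi w2 v = -1.
  have [i wi] : exists i, w2 0 i != 0.
    apply/existsP; rewrite -negb_forall; apply: contra w20 => /forallP H.
    by apply/eqP/rowP => i; rewrite mxE; apply/eqP/H.
  by exists (delta_mx 0 i); rewrite chiC /chi dot_delta /sgn (negbTE wi).
have half : #|[set y : 'rV['F_2]_l | chi w2 y == 1]| = (2 ^ l.-1)%N /\
    #|[set y : 'rV['F_2]_l | chi w2 y != 1]| = (2 ^ l.-1)%N.
  have E : #|[set y : 'rV['F_2]_l | chi w2 y == 1]| = #|[set y : 'rV['F_2]_l | chi w2 y != 1]|.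
    rewrite -!sum1_card (reindex_inj (addIr v)) /=; apply: eq_bigl => y.
    rewrite !inE chiDr v1; rewrite /chi /sgn; case: ifP => _ //.
  have := cardsC [set y : 'rV['F_2]_l | chi w2 y == 1].
  have -> : ~: [set y : 'rV['F_2]_l | chi w2 y == 1] = [set y : 'rV['F_2]_l | chi w2 y != 1].
    by apply/setP => y; rewrite !inE.
  rewrite -E card_mx card_Fp // mul1n.
  have -> : (2 ^ l = 2 ^ l.-1 + 2 ^ l.-1)%N by rewrite addnn -mul2n -expnS prednK.
  by move: #|_| (2 ^ l.-1)%N => c p; split; lia.
rewrite -(pair_big predT predT (fun i (y : 'rV_l) =>
  1 + (chi (row_mx w1 w2) (colvec (i, y)))%:P * 'X)) /=.
rewrite mulnC exprM -[X in _ = _ ^+ X](card_ord 5) -prodr_const; apply: eq_bigr => i _.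
under eq_bigr do rewrite chi_row_mx /=.
set c := chi w1 (pent i).
have c2 : c * c = 1 by exact: chi_sq.
rewrite (bigID (fun y : 'rV_l => y \in [set y : 'rV['F_2]_l | chi w2 y == 1])) /=.
rewrite (eq_bigr (fun=> 1 + c%:P * 'X)) => [|y]; last first.
  by rewrite inE => /eqP ->; rewrite mulr1.
rewrite prodr_const half.1 (eq_bigr (fun=> 1 - c%:P * 'X)) => [|y]; last first.
  rewrite inE => y1; have -> : chi w2 y = -1.
    by move: y1; rewrite /chi /sgn; case: ifP.
  by rewrite mulrN1 polyCN mulNr.
have -> : \prod_(y | y \notin [set y : 'rV['F_2]_l | chi w2 y == 1]) (1 - c%:P * 'X) =
    (1 - c%:P * 'X) ^+ (2 ^ l.-1).
  by rewrite -half.2 -prodr_const; apply: eq_bigl => y; rewrite !inE.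
rewrite -exprMn mulrC -subr_sqr expr1n exprMn -polyC_exp expr2 c2.
by rewrite polyC1 mul1r.
Qed.

Lemma row_poly_left n (g : 'I_n -> X) w1 :
  row_poly g (row_mx w1 0) = \prod_i (1 + (chi w1 (pent i))%:P * 'X) ^+ fibre g i.
Proof.
rewrite /row_poly /sign_poly (partition_big (fun j => (g j).1) predT) //=.
apply: eq_bigr => i _.
rewrite (eq_bigr (fun=> 1 + (chi w1 (pent i))%:P * 'X)) => [|j /eqP <-].
  by rewrite prodr_const; congr (_ ^+ _); apply: eq_card => j; rewrite inE.
by rewrite chi_row_mx [chi 0 _]chiC chi0r mulr1.
Qed.

Lemma row_poly_right n u (g : 'I_n -> X) (h : 'I_u -> X) w1 (w2 : 'rV_l) :
  complementary g h -> w2 != 0 ->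
  (1 - 'X^2) ^+ u * row_poly g (row_mx w1 w2) =
  (1 - 'X^2) ^+ (5 * 2 ^ l.-1) * row_poly_opp h (row_mx w1 w2).
Proof.
move=> gh w20.
have E : row_poly g (row_mx w1 w2) * row_poly h (row_mx w1 w2) =
    (1 - 'X^2) ^+ (5 * 2 ^ l.-1).
  rewrite -(full_poly w1 w20) /row_poly /sign_poly.
  exact: (big_complementary gh _ (fun x => 1 + (chi (row_mx w1 w2) (colvec x))%:P * 'X)).
by rewrite -E -(row_polyM h (row_mx w1 w2)) mulrC mulrA.
Qed.

(** Summation over [w] of the identities for single characters. Those with [w2 = 0] depend only on
    the class sizes and drop out of the differences [F] and [G]. *)
Lemma zero_sums_complementary n u (g g' : 'I_n -> X) (h h' : 'I_u -> X) i :
  complementary g h -> complementary g' h' -> (forall c, fibre h c = fibre h' c) ->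
  let zg j := zero_sums (fun c => colvec (g c)) j in
  let zg' j := zero_sums (fun c => colvec (g' c)) j in
  let zh j := zero_sums (fun c => colvec (h c)) j in
  let zh' j := zero_sums (fun c => colvec (h' c)) j in
  (forall j, (j < i)%N -> zh j = zh' j) ->
  (forall j, (j < i)%N -> zg j = zg' j) /\
  (zg i)%:R - (zg' i)%:R = (-1) ^+ i * ((zh i)%:R - (zh' i)%:R) :> int.
Proof.
move=> gh gh' ff zg zg' zh zh' Hi.
have ffg c : fibre g c = fibre g' c.
  by apply: (mulrIn (oner_neq0 int)); rewrite (fibre_compl gh) (fibre_compl gh') ff.
pose F := \sum_w (row_poly g w - row_poly g' w).
pose G := \sum_w (row_poly_opp h w - row_poly_opp h' w).
pose N : int := (2 ^ (4 + l))%N%:R.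
have N0 : N != 0 by rewrite pnatr_eq0 expn_eq0.
have EF j : F`_j = N * ((zg j)%:R - (zg' j)%:R).
  rewrite mulrBr (zero_sums_row_poly g) (zero_sums_row_poly g') -sumrB coef_sum.
  by apply: eq_bigr => w _; rewrite coefB.
have EG j : G`_j = N * ((-1) ^+ j * ((zh j)%:R - (zh' j)%:R)).
  rewrite mulrCA mulrBr (zero_sums_row_poly h) (zero_sums_row_poly h') -sumrB.
  rewrite mulr_sumr coef_sum; apply: eq_bigr => w _.
  rewrite coefB mulrBr.
  exact: (f_equal2 (fun a b => a - b) (coef_row_poly_opp h w j) (coef_row_poly_opp h' w j)).
have FG : (1 - 'X^2) ^+ u * F = (1 - 'X^2) ^+ (5 * 2 ^ l.-1) * G.
  rewrite /F /G !sum_row_mx !mulr_sumr; apply: eq_bigr => w1 _.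
  rewrite !mulr_sumr (bigD1 0) //= [RHS](bigD1 0) //=; congr (_ + _); last first.
    apply: eq_bigr => w2 w20; rewrite [LHS]mulrBr [RHS]mulrBr.
    exact: (f_equal2 (fun a b => a - b) (row_poly_right w1 gh w20) (row_poly_right w1 gh' w20)).
  rewrite !row_poly_left (eq_bigr (fun c => (1 + (chi w1 (pent c))%:P * 'X) ^+ fibre g' c)).
    rewrite subrr mulr0; have -> : row_poly_opp h (row_mx w1 0) = row_poly_opp h' (row_mx w1 0).
      (* Equal class sizes make the polynomials of [h] and [h'] agree here, hence also their
         cofactors in (1 - X^2)^u. *)
      apply: (mulfI (x := row_poly h (row_mx w1 0))).
        rewrite row_poly_left; apply/prodf_neq0 => c _; rewrite expf_neq0 //.
        apply/eqP => /(congr1 (fun r : {poly int} => r`_0)).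
        by rewrite coefD coef1 coefCM coefX mulr0 addr0 coef0.
      apply: (etrans (row_polyM h _)); apply: (etrans (esym (row_polyM h' (row_mx w1 0)))).
      apply: (f_equal2 (fun a b => a * b) _ erefl).
      rewrite (row_poly_left h) (row_poly_left h').
      by apply: eq_bigr => c _; rewrite ff.
    by rewrite subrr mulr0.
  by move=> c _; rewrite ffg.
have c0 m : ((1 - 'X^2 : {poly int}) ^+ m)`_0 = 1.
  by rewrite -horner_coef0 horner_exp hornerD hornerN hornerXn hornerC expr0n subr0 expr1n.
have [|HF HFi] := eq_coef_lex (c0 u) (c0 _) FG (i := i).
  by move=> j /Hi E; rewrite EG E subrr !mulr0.
split.
  move=> j ji; have := HF j ji; rewrite EF => /eqP.
  by rewrite mulf_eq0 (negbTE N0) subr_eq0 eqr_nat => /eqP.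
by move: HFi; rewrite EF EG => /(mulfI N0).
Qed.

End Patterns.

(** * Comparison of fourth moments *)

(** One sixteenth of the difference of the fourth moments of D and D-bar, for class size [w] and
    power sums u, q2, q3 of the f_i; the terms in q2^2 and in the fourth power sum cancel. *)
Definition quartic (w u q2 q3 : int) : int :=
  65 * w ^+ 4 - 52 * w ^+ 3 * u + 12 * w ^+ 2 * u ^+ 2
  + (18 * w ^+ 2 - 12 * w * u) * q2 + 8 * w * q3.

Lemma quarticE (w : int) (f : 'I_5 -> int) :
  3 * (\sum_i (w - f i) ^+ 2) ^+ 2 - 2 * \sum_i (w - f i) ^+ 4
  - (3 * (\sum_i f i ^+ 2) ^+ 2 - 2 * \sum_i f i ^+ 4) =
  quartic w (\sum_i f i) (\sum_i f i ^+ 2) (\sum_i f i ^+ 3).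
Proof.
rewrite /quartic !big_ord_recl !big_ord0.
move: (f _) (f _) (f _) (f _) (f _) => x0 x1 x2 x3 x4; ring.
Qed.

(** The density 17/64 reads 4u <= 3w and makes the coefficient of q2 nonnegative, so the bounds for
    balanced f_i may be inserted. The term w u^3 stands for the moment of D-bar, which is at most 16
    w u^3. *)
Lemma quartic_bound (w u q2 q3 : int) :
  0 <= w -> 4 * u <= 3 * w -> 0 <= u ->
  5 * q2 <= u ^+ 2 + 6 -> 25 * q3 <= u ^+ 3 + 18 * u + 48 ->
  25 * (quartic w u q2 q3 + w * u ^+ 3) <=
  w * (1625 * w ^+ 3 - 1300 * w ^+ 2 * u + 390 * w * u ^+ 2 - 27 * u ^+ 3
       + 540 * w - 216 * u + 384).
Proof.
move=> w0 uw u0 h2 h3.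
have c0 : 0 <= 5 * (18 * w ^+ 2 - 12 * w * u) by nra.
have := ler_wpM2l c0 h2; have := ler_wpM2l w0 h3; rewrite /quartic.
by nra.
Qed.

Lemma even_gap (w u q2 q3 : int) :
  2 <= w -> 4 * u <= 3 * w -> 0 <= u ->
  5 * q2 <= u ^+ 2 + 6 -> 25 * q3 <= u ^+ 3 + 18 * u + 48 ->
  16 * (quartic w u q2 q3 + w * u ^+ 3) < 2 * (5 * w - u) ^+ 4.
Proof.
move=> w2 uw u0 h2 h3; have w0 : 0 <= w by lia.
have := quartic_bound w0 uw u0 h2 h3; move: (quartic _ _ _ _ + _) => Q hQ.
suff S : 8 * w * (1625 * w ^+ 3 - 1300 * w ^+ 2 * u + 390 * w * u ^+ 2 - 27 * u ^+ 3
       + 540 * w - 216 * u + 384) < 25 * (5 * w - u) ^+ 4 by clear -S hQ; lra.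
have [w3|w3] := lerP 3 w; last first.
  have -> : w = 2 by clear -w2 w3; lia.
  (* The lower order terms are absorbed from w = 3 on; for w = 2 just these two values satisfy 4u <=
     3w. *)
  have : (u == 0) || (u == 1) by clear -w2 w3 uw u0; lia.
  by case/orP => /eqP ->; clear; lra.
rewrite -subr_gt0.
have k0 : 0 <= 3 * w - 4 * u by clear -w0 uw w3; lra.
have k1 : 0 <= w - 3 by clear -w0 uw w3; lra.
have p1 : 0 <= w ^+ 3 * (3 * w - 4 * u) by rewrite mulr_ge0 ?exprn_ge0.
have p2 : 0 <= w * u ^+ 2 * (3 * w - 4 * u) by rewrite !mulr_ge0 ?exprn_ge0.
have p3 : 0 <= (w * u) ^+ 2 by rewrite sqr_ge0.
have p4 : 0 <= (u ^+ 2) ^+ 2 by rewrite sqr_ge0.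
have p5 : 0 <= w * u by rewrite mulr_ge0.
have k2 : 0 <= w + 3 by clear -w0 uw w3; lra.
have p6 : 0 <= w ^+ 2 * ((w - 3) * (w + 3)) by rewrite !mulr_ge0 ?exprn_ge0.
have p7 : 0 <= w * (w - 3) by rewrite mulr_ge0.
clear -w2 p1 p2 p3 p4 p5 p6 p7; lra.
Qed.

(** Dimension 5: 16 w = N = 32 p gives w = 2p, and n = 10p - u <= 9p gives p <= u and the deficiency
    9p - n = u - p. *)
Lemma nine_gap (p u q2 q3 : int) :
  p <= u -> 2 * u <= 3 * p -> 1 <= p ->
  5 * q2 <= u ^+ 2 + 6 -> 25 * q3 <= u ^+ 3 + 18 * u + 48 ->
  16 * (quartic (2 * p) u q2 q3 + 2 * p * u ^+ 3) <
  32 * (393 * p ^+ 4 - 196 * p ^+ 3 * (u - p)).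
Proof.
move=> pu up p1 h2 h3; have u0 : 0 <= u by lia.
have p0 : 0 <= 2 * p by lia.
have up' : 4 * u <= 3 * (2 * p) by lia.
have := quartic_bound p0 up' u0 h2 h3; move: (quartic _ _ _ _ + _) => Q hQ.
suff G : 0 < 1725 * p ^+ 3 + 300 * p ^+ 2 * u - 780 * p * u ^+ 2 + 27 * u ^+ 3
    - 1080 * p + 216 * u - 384.
  have p20 : 0 < 2 * p by clear -p1; lia.
  have := mulr_gt0 p20 G; clear -hQ; nra.
have -> : 1725 * p ^+ 3 + 300 * p ^+ 2 * u - 780 * p * u ^+ 2 + 27 * u ^+ 3
    - 1080 * p + 216 * u - 384 = 390 * (p * (u - p) * (3 * p - 2 * u))
    + 825 * (p ^+ 2 * (3 * p - 2 * u)) + 420 * p ^+ 3 + 27 * u ^+ 3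
    - 1080 * p + 216 * u - 384 by ring.
have [p2|p2] := lerP 2 p; last first.
  have p1' : p = 1 by clear -p1 p2; lia.
  have u1 : u = 1 by clear -p1' pu up; lia.
  by rewrite p1' u1; clear; lra.
have k0 : 0 <= 3 * p - 2 * u by clear -pu up p2; lra.
have k1 : 0 <= u - p by clear -pu up p2; lra.
have k2 : 0 <= p by clear -pu up p2; lra.
have p3 : 4 * p <= p ^+ 3 by clear -p2; nra.
have p4 : p ^+ 3 <= u ^+ 3 by rewrite lerXn2r.
have p5 : 0 <= p * (u - p) * (3 * p - 2 * u) by rewrite !mulr_ge0.
have p6 : 0 <= p ^+ 2 * (3 * p - 2 * u) by rewrite mulr_ge0 ?exprn_ge0.
move: (p ^+ 3) (u ^+ 3) (p * _ * _) (p ^+ 2 * _) p2 pu p3 p4 p5 p6; clear => *; lra.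
Qed.

(** Dimension 6: 16 w = N = 64 p gives w = 4p, and n = 17p gives u = 3p. *)
Lemma seventeen_gap (p q2 q3 : int) :
  1 <= p ->
  5 * q2 <= (3 * p) ^+ 2 + 6 -> 25 * q3 <= (3 * p) ^+ 3 + 18 * (3 * p) + 48 ->
  16 * (quartic (4 * p) (3 * p) q2 q3 + 4 * p * (3 * p) ^+ 3) < 64 * 2273 * p ^+ 4.
Proof.
move=> p1 h2 h3.
have p0 : 0 <= 4 * p by lia.
have p3 : 0 <= 3 * p by lia.
have p34 : 4 * (3 * p) <= 3 * (4 * p) by lia.
have := quartic_bound p0 p34 p3 h2 h3; move: (quartic _ _ _ _ + _) => Q hQ.
have p2 : p <= p ^+ 2 by clear -p1; nra.
have p4 : p ^+ 2 <= p ^+ 4 by rewrite ler_weXn2l.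
clear -p1 p2 p4 hQ; lra.
Qed.

Lemma lex_le_cons (x y : int) (s1 s2 : seq int) :
  lex_le (x :: s1) (y :: s2) = (x < y) || ((x == y) && lex_le s1 s2).
Proof.
rewrite /lex_le lexi_cons; case: ltgtP => //= _.
Qed.

Lemma lex_leP (f g : nat -> int) m len :
  lex_le [seq f i | i <- iota m len] [seq g i | i <- iota m len] <->
  (forall i, (m <= i < m + len)%N -> f i = g i) \/
  exists2 i, (m <= i < m + len)%N &
    (forall j, (m <= j < i)%N -> f j = g j) /\ f i < g i.
Proof.
elim: len m => [|len IH] m /=.
  split=> // _; left=> i; rewrite addn0; lia.
rewrite lex_le_cons; split.
  case/orP => [lt|/andP[/eqP E /IH[H|[i Hi [H1 H2]]]]].
  - right; exists m; first by lia.
    by split=> // j; lia.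
  - left=> i Hi; case: (ltngtP m i) => [mi||<- //]; first by apply: H; lia.
    by lia.
  - right; exists i; first by lia.
    split=> // j Hj; case: (ltngtP m j) => [mj||<- //]; first by apply: H1; lia.
    by lia.
case=> [H|[i Hi [H1 H2]]].
  apply/orP; right; rewrite H ?eqxx; last by lia.
  by apply/IH; left=> i Hi; apply: H; lia.
have [Em|mi] := eqVneq i m; first by rewrite -Em H2.
apply/orP; right; rewrite H1 ?eqxx; last by lia.
apply/IH; right; exists i; first by lia.
by split=> // j Hj; apply: H1; lia.
Qed.

(** * Balanced class sizes *)

Section Balanced.
Variable f : 'I_5 -> nat.
Hypothesis bal : forall i j, (f i <= f j + 1)%N.

Lemma balanced_range : exists b : nat, forall i, f i = b \/ f i = b.+1.
Proof.
pose i0 := [arg min_(i < ord0) f i]%N.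
exists (f i0) => i; have := bal i i0.
have : (f i0 <= f i)%N by rewrite /i0; case: arg_minnP => // j _; apply.
lia.
Qed.

(** If r of the values are b + 1 and the others b, then 5 q2 - u^2 = r(5 - r) <= 6 and 25 q3 - u^3 =
    3u r(5 - r) + r(5 - r)(5 - 2r). *)
Lemma balanced_squares :
  let u : int := \sum_i (f i)%:R in
  5 * \sum_i (f i)%:R ^+ 2 <= u ^+ 2 + 6 /\
  25 * \sum_i (f i)%:R ^+ 3 <= u ^+ 3 + 18 * u + 48.
Proof.
have [b Hb] := balanced_range.
rewrite !big_ord_recl !big_ord0 /=.
have b0 : 0 <= b%:R :> int by [].
have S x : x = b \/ x = b.+1 -> (x%:R : int) = b%:R \/ (x%:R : int) = b%:R + 1.
  by move=> [->|->]; [left|right; rewrite -addn1 natrD].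
move: (S _ (Hb ord0)) (S _ (Hb (lift ord0 ord0)))
 (S _ (Hb (lift ord0 (lift ord0 ord0)))) (S _ (Hb (lift ord0 (lift ord0 (lift ord0 ord0)))))
 (S _ (Hb (lift ord0 (lift ord0 (lift ord0 (lift ord0 ord0)))))).
move: (b%:R) b0; clear.
move=> b b0; do 5!(move=> [->|->]); split; lra.
Qed.

(** For integers (x - b)(x - b - 1) >= 0, with equality only at b and b + 1. Up to terms fixed by
    the total, squares and cubes are sums of this product with weights 1 and x + 2b + 1. Equality
    leaves the values b and b + 1, whose multiplicities the total determines. *)
Lemma balanced_min (f' : 'I_5 -> nat) :
  (\sum_i f i = \sum_i f' i)%N ->
  [/\ \sum_i ((f i)%:R : int) ^+ 2 <= \sum_i (f' i)%:R ^+ 2,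
      \sum_i ((f i)%:R : int) ^+ 3 <= \sum_i (f' i)%:R ^+ 3 &
      \sum_i ((f' i)%:R : int) ^+ 2 <= \sum_i (f i)%:R ^+ 2 ->
      exists s : 'S_5, forall i, f' i = f (s i)].
Proof.
move=> sum_eq.
have [b Hb] := balanced_range.
set B : int := b%:R.
have R i : (f i)%:R = B \/ (f i)%:R = B + 1.
  by case: (Hb i) => ->; [left|right; rewrite -addn1 natrD].
have sumE : \sum_i ((f i)%:R : int) = \sum_i (f' i)%:R by rewrite -!natr_sum sum_eq.
have gap (x : nat) : x = b \/ x = b.+1 \/ 0 < (x%:R - B) * (x%:R - B - 1).
  have [lt|gt|->] := ltngtP x b; last by left.
    right; right; have : x%:R + 1 <= B by rewrite -(natrD _ x 1) ler_nat addn1.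
    by clear; clearbody B; move: (x%:R) => y c; nra.
  have [lt|gt'|->] := ltngtP x b.+1; last by right; left.
    by exfalso; move: lt gt; clear; lia.
  right; right; have : B + 2 <= x%:R by rewrite -(natrD _ b 2) ler_nat addn2.
  by clear; clearbody B; move: (x%:R) => y c; nra.
have gap0 (x : nat) : 0 <= (x%:R - B) * (x%:R - B - 1).
  have [->|[->|/ltW//]] := gap x; first by rewrite subrr mul0r.
  by rewrite -addn1 natrD addrAC subrr add0r subrr mulr0.
have D2 : \sum_i ((f' i)%:R : int) ^+ 2 - \sum_i (f i)%:R ^+ 2 =
    \sum_i ((f' i)%:R - B) * ((f' i)%:R - B - 1).
  have E (h : 'I_5 -> nat) : \sum_i ((h i)%:R : int) ^+ 2 =
      \sum_i ((h i)%:R - B) * ((h i)%:R - B - 1) + (2 * B + 1) * \sum_i (h i)%:R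
      - \sum_(i < 5) B * (B + 1).
    by rewrite mulr_sumr -big_split -sumrB; apply: eq_bigr => i _ /=; ring.
  rewrite E (E f) sumE [X in _ - (X + _ - _)]big1; first by ring.
  by move=> i _; case: (R i) => ->; ring.
split.
- by rewrite -subr_ge0 D2 sumr_ge0.
- have E (h : 'I_5 -> nat) : \sum_i ((h i)%:R : int) ^+ 3 =
      \sum_i ((h i)%:R - B) * ((h i)%:R - B - 1) * ((h i)%:R + 2 * B + 1)
      + (3 * B ^+ 2 + 3 * B + 1) * \sum_i (h i)%:R
      - \sum_(i < 5) B * (B + 1) * (2 * B + 1).
    by rewrite mulr_sumr -big_split -sumrB; apply: eq_bigr => i _ /=; ring.
  rewrite (E f) (E f') sumE !lerD2r big1; last first.
    by move=> i _; case: (R i) => ->; ring.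
  by rewrite sumr_ge0 // => i _; rewrite mulr_ge0 // !addr_ge0 ?mulr_ge0.
rewrite -subr_le0 D2 => le0.
have Hb' i : f' i = b \/ f' i = b.+1.
  have [|[|lt]] := gap (f' i); [by left|by right|].
  move: le0; rewrite leNgt => /negP[]; rewrite (bigD1 i) //=.
  by rewrite ltr_wpDr // sumr_ge0.
have cnt (h : 'I_5 -> nat) : (forall i, h i = b \/ h i = b.+1) ->
    (\sum_i h i = 5 * b + #|[set i | h i == b.+1]|)%N.
  move=> Hh; have -> : (5 * b = \sum_(i < 5) b)%N by rewrite sum_nat_const card_ord.
  rewrite -sum1_card [X in (_ + X)%N]big_mkcond -big_split /=.
  apply: eq_bigr => i _; rewrite inE.
  by case: (Hh i) => ->; rewrite ?eqxx ?addn1 // ltn_eqF ?addn0.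
have Ec : #|[set i | f i == b.+1]| = #|[set i | f' i == b.+1]|.
  by apply/eqP; rewrite -(eqn_add2l (5 * b)) -!cnt // sum_eq.
have tup (h : 'I_5 -> nat) v : count_mem v [tuple h i | i < 5] = #|[set i | h i == v]|.
  rewrite /= count_map -sum1_count -sum1_card big_enum_cond /=.
  by apply: eq_bigl => i; rewrite inE.
have P : perm_eq [tuple f' i | i < 5] [tuple f i | i < 5].
  apply/allP => v _; rewrite /= !tup; apply/eqP.
  have [->|vb1] := eqVneq v b.+1; first by rewrite Ec.
  have [->|vb] := eqVneq v b.
    have C (h : 'I_5 -> nat) : (forall i, h i = b \/ h i = b.+1) ->
        [set i | h i == b] = ~: [set i | h i == b.+1].
      move=> Hh; apply/setP => i; rewrite !inE.
      by case: (Hh i) => ->; rewrite ?eqxx ?(ltn_eqF (ltnSn b)) // gtn_eqF.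
    by rewrite (C f) // (C f') // [LHS]cardsCs [RHS]cardsCs !setCK Ec.
  have Z (h : 'I_5 -> nat) : (forall i, h i = b \/ h i = b.+1) -> [set i | h i == v] = set0.
    move=> Hh; apply/setP => i; rewrite !inE.
    by case: (Hh i) => ->; rewrite eq_sym ?(negbTE vb) ?(negbTE vb1).
  by rewrite (Z f) // (Z f').
have /tuple_permP[s Es] := P.
exists s => i; have := congr1 (fun t => tnth t i) (val_inj Es).
by rewrite !tnth_mktuple.
Qed.

End Balanced.

Lemma dotE k (w v : 'rV['F_2]_k) : dot w v = \sum_l w 0 l * v 0 l.
Proof. by rewrite /dot mxE; apply: eq_bigr => l _; rewrite mxE. Qed.

Lemma dot_sum k (w : 'rV['F_2]_k) (I : Type) (r : seq I) (P : pred I) F :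
  dot w (\sum_(i <- r | P i) F i) = \sum_(i <- r | P i) dot w (F i).
Proof.
apply: (big_morph (dot w) (dotDr w)).
by rewrite /dot trmx0 mulmx0 mxE.
Qed.

(** * Coordinates for designs *)

(** The runs range over all of F_2^k, so a vector orthogonal to every run is zero. *)
Lemma A_zero_sums N n k (Y : 'M['F_2]_(N, n)) (a : 'I_n -> 'rV['F_2]_k)
    (x : 'I_N -> 'rV['F_2]_k) i :
  bijective x -> (forall r j, Y r j = dot (x r) (a j)) -> A i Y = zero_sums a i.
Proof.
move=> [y _ yx] HY; rewrite /A /zero_sums; congr #|pred_of_set _|.
apply/setP => T; rewrite !inE; congr andb.
have E r : (\sum_(j in T) col j Y) r 0 = dot (x r) (\sum_(j in T) a j).
  by rewrite summxE dot_sum; apply: eq_bigr => j _; rewrite mxE HY.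
apply/eqP/eqP => H; last first.
  by apply/colP => r; rewrite E H /dot trmx0 mulmx0 !mxE.
apply/rowP => l; rewrite mxE -dot_delta -(yx (delta_mx 0 l)) -E H.
by rewrite mxE.
Qed.

Lemma zero_sums_gt k n (a : 'I_n -> 'rV['F_2]_k) i : (n < i)%N -> zero_sums a i = 0%N.
Proof.
move=> ni; apply/eqP; rewrite cards_eq0; apply/eqP/setP => T; rewrite !inE.
apply/negP => /andP[/eqP E _]; have := max_card (mem T).
by rewrite E card_ord leqNgt ni.
Qed.

Lemma zero_sums0 k n (a : 'I_n -> 'rV['F_2]_k) : zero_sums a 0 = 1%N.
Proof.
apply: etrans (cards1 (set0 : {set 'I_n})); congr #|pred_of_set _|.
apply/setP => T; rewrite !inE cards_eq0; case: eqP => //= ->.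
by rewrite big_set0 eqxx.
Qed.

Lemma eq_zero_sums k k' n (a : 'I_n -> 'rV['F_2]_k) (b : 'I_n -> 'rV['F_2]_k') :
  (forall T : {set 'I_n}, (\sum_(j in T) a j == 0) = (\sum_(j in T) b j == 0)) ->
  forall i, zero_sums a i = zero_sums b i.
Proof.
by move=> H i; congr #|pred_of_set _|; apply/setP => T; rewrite !inE H.
Qed.

Lemma row_mx_head s (v : 'rV['F_2]_(1 + s)) c :
  lsubmx v 0 0 = c -> row_mx (const_mx c) (rsubmx v) = v.
Proof.
move=> <-; rewrite -[RHS]hsubmxK; congr row_mx.
by apply/rowP => j; rewrite !ord1 mxE.
Qed.

(* [double Y] adds to [Y] the product of a new row bit and a new column bit. *)
Lemma doubles_coordinates N n (Y : 'M['F_2]_(N, n)) s :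
  exists (p : 'I_(dsize s N) -> 'I_N * 'rV['F_2]_s)
         (q : 'I_(dsize s n) -> 'I_n * 'rV['F_2]_s),
  [/\ bijective p, bijective q,
      forall i j, doubles Y s i j = Y (p i).1 (q j).1 + dot (p i).2 (q j).2 &
      forall j, source j = (q j).1].
Proof.
elim: s => [|s [p [q [bp bq E S]]]].
  exists (fun i => (i, 0)), (fun j => (j, 0)).
  have b m : bijective (fun i : 'I_m => (i, 0 : 'rV['F_2]_0)).
    by exists fst => [|[i v]] //=; congr pair; apply/rowP => -[].
  by split=> //= i j; rewrite dotE big_ord0 addr0.
pose ext m (r : 'I_(dsize s m) -> 'I_m * 'rV['F_2]_s) (i : 'I_(dsize s.+1 m)) :
    'I_m * 'rV['F_2]_(s.+1) :=
  match split (i : 'I_(dsize s m + dsize s m)) with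
  | inl c => ((r c).1, row_mx (const_mx 0 : 'rV_1) (r c).2)
  | inr c => ((r c).1, row_mx (const_mx 1 : 'rV_1) (r c).2)
  end.
have bext m (r : 'I_(dsize s m) -> 'I_m * 'rV['F_2]_s) : bijective r -> bijective (ext m r).
  case=> r' rK r'K.
  pose back (v : 'I_m * 'rV['F_2]_(s.+1)) : 'I_(dsize s m + dsize s m) :=
    let c := r' (v.1, rsubmx (v.2 : 'rV_(1 + s))) in
    if lsubmx (v.2 : 'rV_(1 + s)) 0 0 == 0 then lshift _ c else rshift _ c.
  exists back => [i|[i v]].
    rewrite /back /ext; case: (splitP (i : 'I_(dsize s m + dsize s m))) => c Hc /=;
      rewrite row_mxKl row_mxKr -surjective_pairing rK !mxE /=; exact: val_inj.
  rewrite /back /ext /=; case: ifP => v0.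
    rewrite (unsplitK (inl _)) r'K /=; congr pair.
    exact/row_mx_head/eqP.
  rewrite (unsplitK (inr _)) r'K /=; congr pair; apply: row_mx_head.
  by move: v0; case: (F2P (lsubmx (v : 'rV_(1 + s)) 0 0)) => ->.
exists (ext N p), (ext n q); split; try exact: bext.
- move=> i j; rewrite /ext.
  have -> : doubles Y s.+1 i j = (block_mx (doubles Y s) (doubles Y s) (doubles Y s)
      (doubles Y s + const_mx 1)) i j by [].
  have dext (w v : 'rV_1) (w' v' : 'rV_s) : @dot s.+1 (row_mx w w') (row_mx v v') =
      w 0 0 * v 0 0 + dot w' v'.
    by rewrite /dot (@tr_row_mx _ 1 1 s) (@mul_row_col _ 1 1 s) mxE mxE big_ord1 mxE.
  rewrite /block_mx mxE; case: (splitP i) => c Hc; rewrite mxE;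
    case: (splitP j) => e He /=; rewrite dext !mxE ?mul0r ?mulr0 ?add0r //.
  by rewrite mul1r E addrAC -addrA.
- by move=> j /=; rewrite /ext; case: (split _) => c; rewrite /= S.
Qed.

Lemma dot_row_mx k l (w1 v1 : 'rV['F_2]_k) (w2 v2 : 'rV['F_2]_l) :
  dot (row_mx w1 w2) (row_mx v1 v2) = dot w1 v1 + dot w2 v2.
Proof. by rewrite /dot tr_row_mx mul_row_col mxE. Qed.

Lemma even_row_sum (v : 'rV['F_2]_5) :
  ~~ odd #|[set j | v 0 j != 0]| -> \sum_j v 0 j = 0.
Proof.
move=> ev; have -> : \sum_j v 0 j = #|[set j | v 0 j != 0]|%:R.
  rewrite -sum1_card natr_sum [RHS]big_mkcond; apply: eq_bigr => j _; rewrite inE.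
  by case: (F2P (v 0 j)) => ->.
rewrite -(odd_double_half #|_|) (negbTE ev) add0n -muln2 natrM (_ : 2%:R = 0) ?mulr0 //.
exact: val_inj.
Qed.

Lemma dot_pent (w : 'rV['F_2]_4) (i : 'I_5) :
  dot w (pent i) = if (i < 4)%N then w 0 (inord i) else \sum_l w 0 l.
Proof.
rewrite dotE; case: ifP => i4.
  rewrite (bigD1 (inord i)) //= big1 => [|l li].
    by rewrite !mxE inordK // eqxx mulr1 addr0.
  rewrite mxE (_ : (_ || _) = false) ?mulr0 //.
  apply/negbTE; rewrite negb_or (ltn_eqF i4) andbT.
  by apply: contraNneq li => E; apply/eqP/val_inj; rewrite /= inordK.
have i4E : (i : nat) = 4%N by move: i4 (ltn_ord i); case: (i : nat) => [|[|[|[|[|?]]]]].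
by apply: eq_bigr => l _; rewrite mxE i4E eqxx orbT mulr1.
Qed.

Lemma num_runs_pow t : num_runs t = (2 ^ (4 + t.+1))%N.
Proof. by rewrite addnS expnS expnD mulnA. Qed.

Section Design.
Variables (t : nat) (X0 : 'M['F_2]_(16, 5)).
Hypothesis hX0 : is_X0 X0.
Let l := t.+1.
Let m := num_factors t.

Definition X0_head (r : 'I_16) : 'rV['F_2]_4 :=
  \row_(j < 4) X0 r (widen_ord (isT : 4 <= 5)%N j).

Let X0_sum r : \sum_j X0 r j = 0.
Proof.
have /hX0.2/even_row_sum : exists i, row i X0 = row r X0 by exists r.
by under eq_bigr do rewrite mxE.
Qed.

Lemma dot_X0_head r i : dot (X0_head r) (pent i) = X0 r i.
Proof.
rewrite dot_pent; case: ifP => i4.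
  by rewrite mxE; congr (X0 r _); apply: val_inj; rewrite /= inordK.
have -> : i = ord_max.
  by apply: val_inj; move: i4 (ltn_ord i); rewrite /=; case: (i : nat) => [|[|[|[|[|?]]]]].
have := X0_sum r; rewrite big_ord_recr /= => /eqP; rewrite addr_eq0 => /eqP E.
have -> : X0 r ord_max = - X0 r ord_max by case: (F2P (X0 r ord_max)) => ->; apply: val_inj.
by rewrite -E; apply: eq_bigr => j _; rewrite mxE; congr (X0 r _); apply: val_inj.
Qed.

Lemma design_coordinates :
  exists (p : 'I_(num_runs t) -> 'rV['F_2]_(4 + l)) (q : 'I_m -> 'I_5 * 'rV['F_2]_l),
  [/\ bijective p, bijective q,
      forall i j, designX X0 t i j = dot (p i) (colvec (q j)) &
      forall j, designX_source j = (q j).1].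
Proof.
have [p [q [bp bq E S]]] := doubles_coordinates X0 l.
exists (fun i => row_mx (X0_head (p (cast_ord (esym (num_runsE t)) i)).1)
                        (p (cast_ord (esym (num_runsE t)) i)).2),
       (fun j => q (cast_ord (esym (num_factorsE t)) j)); split.
- apply: inj_card_bij; last first.
    by rewrite card_mx card_Fp // card_ord mul1n num_runs_pow.
  move=> i i' /eq_row_mx[E1 E2].
  apply: (@cast_ord_inj _ _ (esym (num_runsE t))); apply: (bij_inj bp).
  rewrite [LHS]surjective_pairing [RHS]surjective_pairing E2; congr pair.
  by apply: hX0.1; apply/rowP => j; rewrite !mxE -!dot_X0_head E1.
- apply: bij_comp bq _; exists (cast_ord (num_factorsE t)).
    exact: cast_ordKV.
  exact: cast_ordK.
- by move=> i j; rewrite /designX castmxE E -dot_X0_head /colvec dot_row_mx.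
- by move=> j; rewrite /designX_source S.
Qed.

Section Projection.
Variables (p : 'I_(num_runs t) -> 'rV['F_2]_(4 + l)) (q : 'I_m -> 'I_5 * 'rV['F_2]_l).
Hypotheses (bp : bijective p) (bq : bijective q).
Hypothesis Xpq : forall i j, designX X0 t i j = dot (p i) (colvec (q j)).

Lemma A_projection n (d : 'I_n -> 'I_m) i :
  A i (colsub d (designX X0 t)) = zero_sums (fun j => colvec (q (d j))) i.
Proof. by apply: (A_zero_sums _ bp) => r j; rewrite mxE Xpq. Qed.

Lemma regular_projection n (d : 'I_n -> 'I_m) :
  regular_design (colsub d (designX X0 t)).
Proof.
exists (4 + l)%N, (fun j => colvec (q (d j))), p; split=> //.
  exact: num_runs_pow.
by move=> i j; rewrite mxE Xpq dotC dotE.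
Qed.

End Projection.
End Design.

(** Up to an invertible factor [A] is the first four columns of the invertible matrix [col_ebase A];
    its other columns complete the coordinates. *)
Lemma complete_coordinates l (A : 'M['F_2]_(4 + l, 4)) : row_full A ->
  exists C : 'M['F_2]_(4 + l, l),
    forall v : 'rV_(4 + l), v *m A = 0 -> v *m C = 0 -> v = 0.
Proof.
move=> /eqP rA; exists (rsubmx (col_ebase A)) => v vA vC.
have vL : v *m col_ebase A = 0.
  rewrite -[LHS]hsubmxK -!mulmx_lsub -!mulmx_rsub vC.
  suff -> : v *m lsubmx (col_ebase A) = 0 by rewrite row_mx0.
  have := vA; rewrite -{1}(mulmx_ebase A) rA pid_mx_col !mulmxA.
  move=> /(congr1 (mulmxr (invmx (row_ebase A)))) /=.
  rewrite mulmxK ?row_ebase_unit // mul0mx => <-.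
  by rewrite -[col_ebase A in RHS]hsubmxK -mulmxA mul_row_col mulmx1 mulmx0 addr0.
by rewrite -[v](mulmxK (col_ebase_unit A)) vL mul0mx.
Qed.

(** The images of the unit vectors determine [L]; the fifth vector follows, since the relation that
    all five sum to zero is symmetric. *)
Lemma pent_perm (s : 'S_5) : exists L : 'M['F_2]_4, forall i, pent i *m L = pent (s i).
Proof.
have sum_pent : \sum_i pent i = 0.
  rewrite !big_ord_recl big_ord0; apply/rowP.
  by case=> -[|[|[|[|//]]]] i; rewrite !mxE; apply: val_inj.
pose w (j : 'I_4) : 'I_5 := widen_ord (isT : 4 <= 5)%N j.
exists (\matrix_(j < 4) pent (s (w j))) => i.
have [i4|i4] := ltnP i 4.
  have -> : i = w (Ordinal i4) by apply: val_inj.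
  have -> : pent (w (Ordinal i4)) = delta_mx 0 (Ordinal i4).
    apply/rowP => j; rewrite !mxE eqxx /= eq_sym.
    by rewrite (ltn_eqF i4) orbF.
  by rewrite -rowE rowK.
have -> : i = ord_max.
  by apply: val_inj; move: i4 (ltn_ord i); rewrite /=; case: (i : nat) => [|[|[|[|[|?]]]]].
have -> : pent ord_max = const_mx 1 by apply/rowP => j; rewrite !mxE orbT.
have := sum_pent; rewrite (reindex_inj (@perm_inj _ s)) big_ord_recr /= => /eqP.
rewrite addv_eq0 => /eqP <-; rewrite mulmx_sum_row; apply: eq_bigr => j _.
by rewrite mxE scale1r rowK; congr (pent (s _)); apply: val_inj.
Qed.

Lemma pent_signs : all (fun i => all (fun j => all (fun k =>
    has (fun m => pent_sign m i * pent_sign m j * pent_sign m k != 1) (below 16))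
  (iota 0 5)) (iota 0 5)) (iota 0 5) &&
  all (fun i => all (fun j => (i == j) ||
    has (fun m => pent_sign m i != pent_sign m j) (below 16)) (iota 0 5)) (iota 0 5).
Proof. by vm_compute. Qed.

Lemma in_iota5 (i : 'I_5) : (i : nat) \in iota 0 5.
Proof. by rewrite mem_iota /=. Qed.

Lemma pent_sum3 i j k : pent i + pent j + pent k != 0.
Proof.
apply/negP => /eqP E; have /andP[+ _] := pent_signs.
move=> /allP/(_ i (in_iota5 i))/allP/(_ j (in_iota5 j))/allP/(_ k (in_iota5 k)).
by move=> /hasP[m _]; rewrite -!chi_bit_row -!chiDr E chi0r eqxx.
Qed.

Lemma pent_inj : injective pent.
Proof.
move=> i j E; apply/val_inj/eqP.
have /andP[_ /allP/(_ i (in_iota5 i))/allP/(_ j (in_iota5 j))/orP[//|/hasP[m _]]] := pent_signs.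
by rewrite -!chi_bit_row E eqxx.
Qed.

Lemma colvec_sum3 l (x y z : 'I_5 * 'rV['F_2]_l) : colvec x + colvec y + colvec z != 0.
Proof.
apply/negP => /eqP/(congr1 lsubmx); rewrite !linearD /= !row_mxKl linear0.
exact/eqP/pent_sum3.
Qed.

Lemma colvec_inj l : injective (@colvec l).
Proof.
by move=> [i x] [j y] /eq_row_mx[/= /pent_inj -> ->].
Qed.

Lemma zero_sums_colvec l n (g : 'I_n -> 'I_5 * 'rV['F_2]_l) i :
  injective g -> (0 < i < 4)%N -> zero_sums (fun j => colvec (g j)) i = 0%N.
Proof.
move=> ginj i4; apply/eqP; rewrite cards_eq0; apply/eqP/setP => T; rewrite !inE.
apply/negP => /andP[/eqP Ti /eqP]; case: i i4 Ti => [|[|[|[|//]]]] // _.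
- move=> /eqP/cards1P[j ->]; rewrite big_set1 => E.
  by have := colvec_sum3 (g j) (g j) (g j); rewrite addvv add0r E eqxx.
- move=> /eqP/cards2P[j [k [jk ->]]]; rewrite big_setU1 ?inE // big_set1 => /eqP.
  by rewrite addv_eq0 => /eqP/colvec_inj/ginj/eqP; apply/negP.
move=> T3; have /card_gt0P[j Tj] : (0 < #|T|)%N by rewrite T3.
have /eqP/cards2P[k [k' [kk E]]] : #|T :\ j| = 2%N.
  by move: T3; rewrite (cardsD1 j) Tj => -[].
rewrite (big_setD1 j) //= E big_setU1 ?inE // big_set1 addrA.
exact/eqP/colvec_sum3.
Qed.

Lemma exists_complement l n u (g : 'I_n -> 'I_5 * 'rV['F_2]_l) :
  injective g -> (n + u = 5 * 2 ^ l)%N ->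
  exists h : 'I_u -> 'I_5 * 'rV['F_2]_l, complementary g h.
Proof.
move=> ginj nu; pose C := ~: [set g j | j : 'I_n].
have Cu : u = #|C|.
  have := cardsC [set g j | j : 'I_n].
  rewrite card_imset // card_ord card_prod card_ord card_mx card_Fp // mul1n -nu.
  by move/addnI.
exists (fun i => enum_val (cast_ord Cu i)); split=> //.
  by move=> i j /enum_val_inj/cast_ord_inj.
have Ec x : (x \in C) = (x \notin codom g).
  rewrite inE; congr (~~ _); apply/imsetP/codomP => [[j _ ->]|[j ->]]; by exists j.
move=> x; rewrite -Ec; apply/codomP/idP => [[i ->]|xC]; first exact: enum_valP.
exists (cast_ord (esym Cu) (enum_rank_in xC x)).
by rewrite cast_ordKV enum_rankK_in.
Qed.

Lemma sum_card_fibre l n (g : 'I_n -> 'I_5 * 'rV['F_2]_l) : (\sum_i fibre g i = n)%N.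
Proof.
rewrite -[RHS](card_ord n) -sum1_card (partition_big (fun j => (g j).1) predT) //=.
by apply: eq_bigr => i _; rewrite /fibre -sum1_card; apply: eq_bigl => j; rewrite inE.
Qed.

(** * Comparing D with a competitor *)

Section Compare.
Variables (k n : nat) (a b : 'I_n -> 'rV['F_2]_k).
Hypotheses (ainj : injective a) (binj : injective b).

Lemma zero_sums4_diff :
  24 * (2 ^ k)%N%:R * ((zero_sums b 4)%:R - (zero_sums a 4)%:R) =
  moment b 4 - moment a 4 :> int.
Proof. by rewrite mulrBr !zero_sums_moment4 !moment2_inj //; ring. Qed.

Lemma zero_sums4_le : (zero_sums a 4 <= zero_sums b 4)%N = (moment a 4 <= moment b 4).
Proof.
rewrite -subr_ge0 -zero_sums4_diff pmulr_rge0 ?subr_ge0 ?ler_nat //.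
by rewrite mulr_gt0 // ltr0n expn_gt0.
Qed.

Lemma zero_sums4_lt : (zero_sums a 4 < zero_sums b 4)%N = (moment a 4 < moment b 4).
Proof.
rewrite -subr_gt0 -zero_sums4_diff pmulr_rgt0 ?subr_gt0 ?ltr_nat //.
by rewrite mulr_gt0 // ltr0n expn_gt0.
Qed.

End Compare.

(** A character sum s satisfies s^2 <= n^2, so s^4 <= n^2 s^2, and the second moment is known. *)
Lemma moment4_le k n (a : 'I_n -> 'rV['F_2]_k) : injective a ->
  moment a 4 <= (2 ^ k)%N%:R * n%:R ^+ 3.
Proof.
move=> ainj; have -> : (2 ^ k)%N%:R * n%:R ^+ 3 = n%:R ^+ 2 * moment a 2 :> int.
  by rewrite moment2_inj //; ring.
rewrite /moment mulr_sumr; apply: ler_sum => w _.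
rewrite (exprD _ 2 2) ler_wpM2r ?sqr_ge0 // -[X in X <= _]real_normK ?num_real //.
rewrite lerXn2r ?nnegrE ?normr_ge0 // (le_trans (ler_norm_sum _ _ _)) //.
rewrite -[X in _ <= X%:R]card_ord -sumr_const; apply: ler_sum => j _.
by rewrite /chi /sgn; case: ifP.
Qed.

Section Optimal.
Variables (l n u : nat).
Hypothesis nu : (n + u = 5 * 2 ^ l)%N.
Hypothesis dense : (17 * 2 ^ (4 + l) <= 64 * n)%N.
Variables (g : 'I_n -> 'I_5 * 'rV['F_2]_l) (h : 'I_u -> 'I_5 * 'rV['F_2]_l).
Hypothesis gh : complementary g h.
Hypothesis bal : forall i j, (fibre h i <= fibre h j + 1)%N.

Let w : int := (2 ^ l)%N%:R.
Let binj m (f : 'I_m -> 'I_5 * 'rV['F_2]_l) :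
  injective f -> injective (fun j => colvec (f j)).
Proof. by move=> finj i j /colvec_inj/finj. Qed.

Let uw : (4 * u <= 3 * 2 ^ l)%N.
Proof. by move: dense nu; rewrite expnD; move: (2 ^ l)%N => W; lia. Qed.

Lemma moment4_quartic (g' : 'I_n -> 'I_5 * 'rV['F_2]_l) (h' : 'I_u -> 'I_5 * 'rV['F_2]_l) :
  complementary g' h' ->
  moment (fun j => colvec (g' j)) 4 = moment (fun j => colvec (h' j)) 4 +
    16 * quartic w u%:R (\sum_i (fibre h' i)%:R ^+ 2) (\sum_i (fibre h' i)%:R ^+ 3).
Proof.
move=> gh'; apply/eqP; rewrite addrC -subr_eq (moment4_complementary gh') -mulrBr.
by rewrite quarticE -natr_sum sum_card_fibre.
Qed.

Lemma moment4_bound :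
  moment (fun j => colvec (g j)) 4 <=
  16 * (quartic w u%:R (\sum_i (fibre h i)%:R ^+ 2) (\sum_i (fibre h i)%:R ^+ 3)
        + w * u%:R ^+ 3).
Proof.
have [_ hinj _] := gh.
rewrite (moment4_quartic gh) [leRHS]mulrDr [leLHS]addrC lerD2l.
apply: le_trans (moment4_le (binj hinj)) _.
by rewrite expnD natrM mulrA.
Qed.

Lemma gap_moment4 k (a : 'I_n -> 'rV['F_2]_k) :
  (0 < l)%N -> k = (4 + l)%N ->
  [\/ 2 * n%:R ^+ 4 <= moment a 4,
      exists P : nat, [/\ (2 ^ k = 32 * P)%N, (n <= 9 * P)%N &
        32 * (393 * P%:R ^+ 4 - 196 * P%:R ^+ 3 * (9 * P%:R - n%:R)) <= moment a 4] |
      exists P : nat, [/\ (2 ^ k = 64 * P)%N, (n = 17 * P)%N &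
        64 * 2273 * P%:R ^+ 4 <= moment a 4]] ->
  moment (fun j => colvec (g j)) 4 < moment a 4.
Proof.
move=> l0 kE H; apply: le_lt_trans moment4_bound _.
have [h2 h3] := balanced_squares bal.
rewrite -natr_sum sum_card_fibre in h2 h3.
have nE : n%:R = 5 * w - u%:R.
  by apply/eqP; rewrite eq_sym subr_eq -natrD nu natrM.
have u0 : 0 <= u%:R :> int by [].
have uw' : 4 * u%:R <= 3 * w by rewrite /w -!natrM ler_nat.
case: H => [H|[P [H1 H2 H]]|[P [H1 H2 H]]]; apply: lt_le_trans H.
- rewrite nE; apply: even_gap => //.
  by rewrite /w (ler_nat _ 2) -{1}(expn1 2) leq_exp2l.
- have W2 : (2 ^ l = 2 * P)%N by move: H1; rewrite kE expnD; lia.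
  have wE : w = 2 * P%:R by rewrite /w W2 natrM.
  rewrite nE wE in uw' *.
  have -> : 9 * P%:R - (5 * (2 * P%:R) - u%:R) = u%:R - P%:R :> int by ring.
  apply: nine_gap => //.
  + by rewrite ler_nat; lia.
  + by rewrite -!natrM ler_nat; lia.
  + by rewrite ler1n; move: W2 (expn_gt0 2 l); case: (P) => // ->; rewrite muln0.
- have W2 : (2 ^ l = 4 * P)%N by move: H1; rewrite kE expnD; lia.
  have wE : w = 4 * P%:R by rewrite /w W2 natrM.
  have uE : u%:R = 3 * P%:R :> int by rewrite -natrM; congr _%:R; lia.
  rewrite wE uE; rewrite uE in h2 h3.
  apply: seventeen_gap => //.
  by rewrite ler1n; move: W2 (expn_gt0 2 l); case: (P) => // ->; rewrite muln0.
Qed.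

(** Both power sums enter with positive coefficients, and balance minimizes both; equality of
    [quartic] therefore forces equal sums of squares. *)
Lemma quartic_min (h' : 'I_u -> 'I_5 * 'rV['F_2]_l) :
  let q (f : 'I_u -> 'I_5 * 'rV['F_2]_l) :=
    quartic w u%:R (\sum_i (fibre f i)%:R ^+ 2) (\sum_i (fibre f i)%:R ^+ 3) in
  q h <= q h' /\ (q h' <= q h -> exists s : 'S_5, forall i, fibre h' i = fibre h (s i)).
Proof.
have [m2 m3 E] := balanced_min bal (f' := fibre h') ltac:(by rewrite !sum_card_fibre).
have w0 : 0 < w by rewrite ltr0n expn_gt0.
have uw' : 4 * u%:R <= 3 * w by rewrite /w -!natrM ler_nat.
have c0 : 0 < 18 * w ^+ 2 - 12 * w * u%:R.
  rewrite (_ : _ - _ = 3 * w * (3 * w + (3 * w - 4 * u%:R))); last by ring.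
  by rewrite !mulr_gt0 // ltr_pwDl ?mulr_gt0 // subr_ge0.
have w8 : 0 <= 8 * w by rewrite mulr_ge0 ?ltW.
split; first by rewrite /quartic lerD // ?lerD2l ler_wpM2l // ltW.
move=> H; apply: E; rewrite -(ler_pM2l c0).
have := ler_wpM2l w8 m3; move: H; rewrite /quartic.
move: (_ * \sum_i _ ^+ 3) (_ * \sum_i (fibre h' i)%:R ^+ 3) => x y.
by rewrite -!addrA !lerD2l => H xy; lra.
Qed.

End Optimal.

(** Starting at 0 and having no upper limit is harmless for word counts: they equal 1 at 0 and
    vanish beyond the number of columns. *)
Definition lex_small (f g : nat -> nat) :=
  (forall i, f i = g i) \/ exists i, (forall j, (j < i)%N -> f j = g j) /\ (f i < g i)%N.

Lemma wordlength_lex k n (N N' : nat) (Y : 'M_(N, n)) (Y' : 'M_(N', n))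
    (a b : 'I_n -> 'rV['F_2]_k) :
  (forall i, A i Y = zero_sums a i) -> (forall i, A i Y' = zero_sums b i) ->
  lex_small (zero_sums a) (zero_sums b) ->
  lex_le (wordlength_pattern Y) (wordlength_pattern Y').
Proof.
move=> HY HY' H; apply/lex_leP; case: H => [E|[i [E lt]]].
  by left=> i _; rewrite HY HY' E.
right; exists i.
  rewrite lt0n add1n ltnS; apply/andP; split.
    by apply: contraTneq lt => ->; rewrite !zero_sums0.
  by rewrite leqNgt; apply: contraTN lt => ni; rewrite (zero_sums_gt b ni).
by split=> [j /andP[_ ji]|]; rewrite HY HY' ?ltz_nat // E.
Qed.

Lemma signed_lex u (N N' : nat) (Y : 'M_(N, u)) (Y' : 'M_(N', u)) :
  lex_le (signed_pattern Y) (signed_pattern Y') ->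
  (forall i, (4 <= i <= u)%N -> A i Y = A i Y') \/
  exists i, [/\ (4 <= i <= u)%N, forall j, (4 <= j < i)%N -> A j Y = A j Y' &
    (-1) ^+ i * (((A i Y)%:R : int) - (A i Y')%:R) < 0].
Proof.
have cancel i (x y : nat) : (-1) ^+ i * x%:Z = (-1) ^+ i * y%:Z -> x = y.
  have s0 : (-1) ^+ i != 0 :> int by rewrite expf_neq0.
  by move=> /(mulfI s0) [].
case/lex_leP => [E|[i Hi [E lt]]].
  by left=> i Hi; apply: (cancel i); apply: E; lia.
right; exists i; split; first by lia.
  by move=> j Hj; apply: (cancel j); apply: E; lia.
by rewrite mulrBr subr_lt0 !natz.
Qed.

(** A permutation of the five classes extends to a linear map, and so does its inverse. *)
Lemma relabel_zero_sums l n (g : 'I_n -> 'I_5 * 'rV['F_2]_l) (s : 'S_5) i :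
  zero_sums (fun j => colvec (s (g j).1, (g j).2)) i = zero_sums (fun j => colvec (g j)) i.
Proof.
have imp (r : 'S_5) (f : 'I_n -> 'I_5 * 'rV['F_2]_l) (T : {set 'I_n}) :
    \sum_(j in T) colvec (f j) = 0 -> \sum_(j in T) colvec (r (f j).1, (f j).2) = 0.
  have [L HL] := pent_perm r.
  pose M := block_mx L 0 0 (1%:M : 'M_l).
  move=> /(congr1 (mulmxr M)) /=; rewrite mul0mx mulmx_suml => E; rewrite -[RHS]E.
  apply: eq_bigr => j _.
  by rewrite /colvec /M mul_row_block !mulmx0 mulmx1 addr0 add0r HL.
apply: eq_zero_sums => T; apply/eqP/eqP => [H|]; last exact: imp.
apply: etrans (imp s^-1%g _ T H).
by apply: eq_bigr => j _ /=; rewrite permK; case: (g j).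
Qed.

Lemma fibre_relabel l n (g : 'I_n -> 'I_5 * 'rV['F_2]_l) (s : 'S_5) i :
  fibre (fun j => (s (g j).1, (g j).2)) (s i) = fibre g i.
Proof.
rewrite /fibre; congr #|pred_of_set _|; apply/setP => j; rewrite !inE /=.
by rewrite (inj_eq perm_inj).
Qed.

Lemma complementary_relabel l n u (g : 'I_n -> 'I_5 * 'rV['F_2]_l)
    (h : 'I_u -> 'I_5 * 'rV['F_2]_l) (s : 'S_5) :
  complementary g h ->
  complementary (fun j => (s (g j).1, (g j).2)) (fun j => (s (h j).1, (h j).2)).
Proof.
case=> ginj hinj H; pose r x : 'I_5 * 'rV['F_2]_l := (s x.1, x.2).
pose r' x : 'I_5 * 'rV['F_2]_l := (s^-1%g x.1, x.2).
have rK : cancel r r' by case=> i v; rewrite /r /r' /= permK.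
have r'K : cancel r' r by case=> i v; rewrite /r /r' /= permKV.
have C m (f : 'I_m -> 'I_5 * 'rV['F_2]_l) x :
    (x \in codom (fun j => r (f j))) = (r' x \in codom f).
  apply/codomP/codomP => [[j ->]|[j E]]; exists j; first by rewrite rK.
  by rewrite -E r'K.
split; [by move=> i j /(can_inj rK)/ginj|by move=> i j /(can_inj rK)/hinj|].
by move=> x; rewrite !C.
Qed.

Theorem theorem4 (t n u : nat) (X0 : 'M['F_2]_(16, 5)) (hX0 : is_X0 X0)
    (hn_lo : (17 * num_runs t <= 64 * n)%N)
    (hn_hi : (16 * n <= 5 * num_runs t)%N)
    (hu : u = (num_factors t - n)%N)
    (d : 'I_n -> 'I_(num_factors t)) (hd : injective d)
    (e : 'I_u -> 'I_(num_factors t)) (he : injective e)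
    (hcompl : forall c : 'I_(num_factors t), (c \in codom e) = (c \notin codom d))
    (h_i : seq_minimized (@signed_pattern (num_runs t) u)
             (@projection_design (num_runs t) (num_factors t) u (designX X0 t))
             (colsub e (designX X0 t)))
    (h_ii : forall i j : 'I_5, (i < j)%N ->
       `|#|[set c : 'I_u | designX_source (e c) == i]|%:Z
         - #|[set c : 'I_u | designX_source (e c) == j]|%:Z| <= 1) :
  minimum_aberration (@regular_design (num_runs t) n) (colsub d (designX X0 t)).
Proof.
have [p [q [bp bq Xpq src]]] := design_coordinates t hX0.
have Aproj := A_projection bp Xpq.
have qinj := bij_inj bq; have [q' qK q'K] := bq.
set l := t.+1 in p q bp bq Xpq src qinj q' qK q'K Aproj *.
pose g j := q (d j); pose h j := q (e j).
have codom_q m (f : 'I_m -> 'I_(num_factors t)) x :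
    (x \in codom (fun j => q (f j))) = (q' x \in codom f).
  apply/codomP/codomP => [[j ->]|[j E]]; exists j; first by rewrite qK.
  by rewrite -E q'K.
have gh : complementary g h.
  split; [by move=> i j /qinj/hd|by move=> i j /qinj/he|].
  by move=> x; rewrite /g /h !codom_q hcompl.
have nu : (n + u = 5 * 2 ^ l)%N.
  by move: hn_hi; rewrite hu /num_factors /num_runs /l expnS; lia.
have dense : (17 * 2 ^ (4 + l) <= 64 * n)%N by rewrite -num_runs_pow.
have fibE i : fibre h i = #|[set c | designX_source (e c) == i]|.
  by apply: eq_card => c; rewrite !inE src.
have near_ij (i j : 'I_5) : (i < j)%N ->
    (fibre h i <= fibre h j + 1)%N /\ (fibre h j <= fibre h i + 1)%N.
  by move/h_ii; rewrite -!fibE; move: (fibre h i) (fibre h j) => x y; lia.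
have bal (i j : 'I_5) : (fibre h i <= fibre h j + 1)%N.
  have [/near_ij[]//|/near_ij[]//|/val_inj ->] := ltngtP i j.
  by rewrite leq_addr.
split; first by apply: regular_projection bp Xpq _ _.
move=> D' [k [a [x [Nk bx HD]]]].
have {Nk}kl : k = (4 + l)%N.
  by apply/eqP; rewrite -(eqn_exp2l _ _ (ltnSn 1)) -Nk num_runs_pow.
subst k.
have AD' i : A i D' = zero_sums a i.
  by apply: (A_zero_sums _ bx) => r j; rewrite HD dotC dotE.
apply: (wordlength_lex (a := fun j => colvec (g j)) (b := a)) => //.
have [ginj hinj _] := gh.
have g0 i : (0 < i < 4)%N -> zero_sums (fun j => colvec (g j)) i = 0%N.
  exact: zero_sums_colvec.
have low i : (0 < i < 4)%N -> (forall j, (0 < j < i)%N -> zero_sums a j = 0%N) ->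
    (0 < zero_sums a i)%N -> lex_small (zero_sums (fun j => colvec (g j))) (zero_sums a).
  move=> Hi E lt; right; exists i; split; last by rewrite g0.
  move=> [|j] ji; first by rewrite !zero_sums0.
  by rewrite E ?g0 //; lia.
have [a1|] := posnP (zero_sums a 1); last by apply: low => // -[].
have [a2|] := posnP (zero_sums a 2).
  2: by apply: low => // -[|[]].
have [a3|] := posnP (zero_sums a 3).
  2: by apply: low => // -[|[|[]]].
have ainj := zero_sums2_inj a2.
have bginj : injective (fun j => colvec (g j)) by move=> i j /colvec_inj/ginj.
have bhinj : injective (fun j => colvec (h j)) by move=> i j /colvec_inj/hinj.
have eq_low j : (j < 4)%N -> zero_sums (fun j => colvec (g j)) j = zero_sums a j.
  by case: j => [|[|[|[|//]]]] _; rewrite ?zero_sums0 // g0.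
have big4 : moment (fun j => colvec (g j)) 4 < moment a 4 ->
    lex_small (zero_sums (fun j => colvec (g j))) (zero_sums a).
  by rewrite -zero_sums4_lt // => lt; right; exists 4.
have gap := gap_moment4 nu dense gh bal (a := a) isT erefl.
case: (competitor_structure a1 a2 a3 dense) => [H|[M fM HM]|H|H].
- by apply/big4/gap; constructor 1.
- have [C MC] := complete_coordinates fM.
  have HMC (v : 'rV_(4 + l)) : v *m row_mx M C = 0 -> v = 0.
    rewrite mul_mx_row => E.
    have /eq_row_mx[vM vC] : row_mx (v *m M) (v *m C) = row_mx 0 0 by rewrite row_mx0.
    exact: MC.
  have [c Hc] := fin_all_exists HM.
  (* Class and position of the competitor's columns: in these coordinates D' is a projection of
     X. *)
  pose g' j := (c j, a j *m C).
  have g'E j : colvec (g' j) = a j *m row_mx M C by rewrite mul_mx_row Hc.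
  have zsE : zero_sums a =1 zero_sums (fun j => colvec (g' j)).
    apply: eq_zero_sums => T; under [in RHS]eq_bigr do rewrite g'E.
    rewrite -mulmx_suml; apply/eqP/eqP => [->|]; first by rewrite mul0mx.
    by move/HMC.
  have g'inj : injective g'.
    move=> i j E; apply/ainj/eqP; rewrite -addv_eq0; apply/eqP/HMC.
    by rewrite mulmxDl -!g'E E addvv.
  have bg'inj : injective (fun j => colvec (g' j)) by move=> i j /colvec_inj/g'inj.
  have [h' gh'] := exists_complement g'inj nu.
  have [_ h'inj _] := gh'.
  have bh'inj : injective (fun j => colvec (h' j)) by move=> i j /colvec_inj/h'inj.
  (* The columns of X complementary to D'; condition (i) is applied against this projection. *)
  pose e' j := q' (h' j).
  have Ae i : A i (colsub e (designX X0 t)) = zero_sums (fun j => colvec (h j)) i.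
    exact: Aproj.
  have Ae' i : A i (colsub e' (designX X0 t)) = zero_sums (fun j => colvec (h' j)) i.
    rewrite Aproj; apply: eq_zero_sums => T.
    by under eq_bigr do rewrite /e' q'K.
  have /signed_lex lexh : lex_le (signed_pattern (colsub e (designX X0 t)))
      (signed_pattern (colsub e' (designX X0 t))).
    by apply: h_i.2; exists e' => // i j /(can_inj q'K)/h'inj.
  have {}lexh : (forall i, zero_sums (fun j => colvec (h j)) i =
                           zero_sums (fun j => colvec (h' j)) i) \/
      exists i, [/\ (4 <= i)%N, forall j, (j < i)%N ->
        zero_sums (fun j => colvec (h j)) j = zero_sums (fun j => colvec (h' j)) j &
        (-1) ^+ i * (((zero_sums (fun j => colvec (h j)) i)%:R : int)
                     - (zero_sums (fun j => colvec (h' j)) i)%:R) < 0].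
    have lo j : (j < 4)%N -> zero_sums (fun j => colvec (h j)) j =
                             zero_sums (fun j => colvec (h' j)) j.
      by case: j => [|[|[|[|//]]]] _; rewrite ?zero_sums0 ?zero_sums_colvec.
    case: lexh => [E|[i [/andP[i4 iu] E lt]]].
      left=> i; have [/lo //|i4] := ltnP i 4; have [iu|ui] := leqP i u.
        by rewrite -Ae -Ae' E // i4 iu.
      by rewrite !zero_sums_gt.
    right; exists i; split=> //; last by rewrite -Ae -Ae'.
    by move=> j ji; have [/lo //|j4] := ltnP j 4; rewrite -Ae -Ae' E // j4 ji.
  (* The sign at i = 4 is positive, so condition (i) begins by minimizing A_4 of D-bar. *)
  have mh : moment (fun j => colvec (h j)) 4 <= moment (fun j => colvec (h' j)) 4.
    rewrite -zero_sums4_le //; case: lexh => [->//|[i [i4 E lt]]].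
    move: i4; rewrite leq_eqVlt => /orP[/eqP i4|/E -> //].
    by move: lt; rewrite -i4 -signr_odd expr0 mul1r subr_lt0 ltr_nat => /ltnW.
  have [qle qperm] := quartic_min nu dense bal h'.
  have mg := moment4_quartic gh; have mg' := moment4_quartic gh'.
  have [le_qq|lt_qq] := lerP (quartic (2 ^ l)%N%:R u%:R (\sum_i (fibre h' i)%:R ^+ 2)
      (\sum_i (fibre h' i)%:R ^+ 3)) (quartic (2 ^ l)%N%:R u%:R
      (\sum_i (fibre h i)%:R ^+ 2) (\sum_i (fibre h i)%:R ^+ 3)); last first.
    (* If the class sizes of D' are worse than balanced, D already wins at A_4. *)
    have lt4 : (zero_sums (fun j => colvec (g j)) 4 < zero_sums (fun j => colvec (g' j)) 4)%N.
      by rewrite zero_sums4_lt // mg mg' ler_ltD // ltr_pM2l.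
    by right; exists 4; split=> //; rewrite zsE.
  have [s Es] := qperm le_qq.
  (* Relabelling the classes turns equality of the class sizes up to order into equality. *)
  pose g2 j := (s (g' j).1, (g' j).2); pose h2 j := (s (h' j).1, (h' j).2).
  have gh2 : complementary g2 h2 by apply: complementary_relabel.
  have ff i : fibre h i = fibre h2 i.
    by rewrite -(permKV s i) fibre_relabel Es.
  have comp i := zero_sums_complementary (isT : (0 < l)%N) (i := i) gh gh2 ff.
  have zg2 i : zero_sums (fun j => colvec (g2 j)) i = zero_sums a i.
    by rewrite zsE; apply: relabel_zero_sums.
  have zh2 i : zero_sums (fun j => colvec (h2 j)) i = zero_sums (fun j => colvec (h' j)) i.
    exact: relabel_zero_sums.
  case: lexh => [E|[i [_ E lt]]].
    left=> i; have [|H _] := comp i.+1; first by move=> j _; rewrite zh2.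
    by rewrite H // zg2.
  (* The first difference of the complements passes to D and D' with the factor (-1)^i, the very
     sign that condition (i) attaches to A_i. *)
  have [|H Hi] := comp i; first by move=> j ji; rewrite zh2 E.
  right; exists i; split; first by move=> j ji; rewrite H // zg2.
  by rewrite -(ltr_nat int) -subr_lt0 -zg2 Hi zh2.
- by apply/big4/gap; constructor 2.
- by apply/big4/gap; constructor 3.
Qed.
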